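(* Let $N>2$, $\alpha\in[0,2)$ and $\beta>2$. Then every normalized eigenfunction $\psi_j$ of $A_2$ (i.e. $\psi_j\in D(A_2)$, $A_2\psi_j=\lambda_j\psi_j$ for some eigenvalue $\lambda_j$, $\|\psi_j\|_{L^2(\mathbb{R}^N)}=1$) satisfies $$|\psi_j(x)|\le C|x|^{\frac{\alpha-\beta}{4}-\frac{N-1}{2}}\exp\left(-\int_1^{|x|}\frac{s^{\beta/2}}{(1+s^\alpha)^{1/2}}\,ds\right)$$ for all $x\in\mathbb{R}^N\setminus B(0,1)$ and a constant $C>0$ (which may depend on $\lambda_j$, but not on $x$).
   Context: $B(0,1)$ is the open unit ball of $\mathbb{R}^N$. Set $a(x)=1+|x|^\alpha$, $V(x)=|x|^\beta$, $\mathcal{A}u=a\Delta u-Vu$. $A_2$ is the realization of $\mathcal{A}$ in $L^2(\mathbb{R}^N)$ with domain $D(A_2)=\{u\in W^{2,2}(\mathbb{R}^N): a|D^2u|,\ a^{1/2}|\nabla u|,\ Vu\in L^2(\mathbb{R}^N)\}$. Eigenfunctions of $A_2$ are identified with their continuous representatives. *)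

(* Defs.v *)
From HB Require Import structures.
From mathcomp Require Import all_boot all_order all_algebra.
From mathcomp Require Import all_classical all_reals all_analysis.
From mathcomp Require Import complex.

Set Implicit Arguments.
Unset Strict Implicit.
Unset Printing Implicit Defensive.

Import Order.TTheory GRing.Theory Num.Theory.
Import numFieldTopology.Exports numFieldNormedType.Exports.
Import Normc.

Local Open Scope classical_set_scope.
Local Open Scope ring_scope.

(* R^N is 'rV[R]_N, whose topology is the library's.  It carries no
   sigma-algebra there; the one generated by the coordinates, added here, is the
   Borel one. *)

Definition rV_display : measure_display -> measure_display.
Proof. exact. Qed.

Section measurable_rV.
Context {R : realType}.
Variable n : nat.

Let coords : 'I_n -> 'rV[R]_n -> R := fun i v => v ord0 i.

Let rV_set0 : g_sigma_preimage coords set0.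
Proof. exact: sigma_algebra0. Qed.

Let rV_setC A : g_sigma_preimage coords A -> g_sigma_preimage coords (~` A).
Proof. exact: sigma_algebraC. Qed.

Let rV_bigcup (F : _^nat) : (forall i, g_sigma_preimage coords (F i)) ->
  g_sigma_preimage coords (\bigcup_i (F i)).
Proof. exact: sigma_algebra_bigcup. Qed.

HB.instance Definition _ := @isMeasurable.Build
  (rV_display default_measure_display)
  'rV[R]_n (g_sigma_preimage coords) rV_set0 rV_setC rV_bigcup.

End measurable_rV.

Lemma measurable_coord (R : realType) n (i : 'I_n) :
  measurable_fun [set: 'rV[R]_n] (fun v : 'rV[R]_n => v ord0 i).
Proof.
move=> _ Y mY; rewrite setTI; apply: sub_sigma_algebra => /=.
rewrite -bigcup_seq/=; exists i => /=; first by rewrite mem_index_enum.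
by exists Y => //; rewrite setTI.
Qed.

Lemma measurable_fun_rVP (R : realType) d (T : measurableType d) n
    (f : T -> 'rV[R]_n) :
  (forall i, measurable_fun setT (fun x => f x ord0 i)) ->
  measurable_fun setT f.
Proof.
move=> mf _ A mA; have sub : measurable `<=` image_set_system setT f measurable.
  apply: smallest_sub; first exact/sigma_algebra_image/sigma_algebra_measurable.
  rewrite -bigcup_seq => B [i _ [Y mY <-]].
  rewrite /image_set_system/= !setTI -comp_preimage -[X in measurable X]setTI.
  exact: mf.
exact: sub.
Qed.

Section lebesgue_rV_step.
Context {R : realType} (n : nat).

Definition rV_cons (p : R * 'rV[R]_n) : 'rV[R]_n.+1 :=
  row_mx (const_mx p.1 : 'rV[R]_1) p.2.

Definition rV_uncons (v : 'rV[R]_n.+1) : R * 'rV[R]_n :=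
  (v ord0 ord0, \row_j v ord0 (lift ord0 j)).

Lemma rV_consK : cancel rV_cons rV_uncons.
Proof.
move=> [x v]; rewrite /rV_uncons /rV_cons; congr pair.
  rewrite (_ : ord0 = lshift n (ord0 : 'I_1)); last exact/val_inj.
  by rewrite (@row_mxEl _ 1 1 n) mxE.
apply/rowP => j; rewrite mxE (_ : lift _ _ = rshift 1 j); last exact/val_inj.
by rewrite (@row_mxEr _ 1 1 n).
Qed.

Lemma measurable_rV_cons : measurable_fun setT rV_cons.
Proof.
apply: measurable_fun_rVP => i; have [->|[j ->]] : i = lshift n (ord0 : 'I_1) \/
    exists j, i = rshift 1 j.
  by case: (@split_ordP 1 n i) => j ->; [left; rewrite ord1|right; exists j].
- rewrite (_ : (fun x => _) = fst) //.
  by apply/funext => x; rewrite /rV_cons (@row_mxEl _ 1 1 n) mxE.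
- rewrite (_ : (fun x => _) = (fun v : 'rV[R]_n => v ord0 j) \o snd); last first.
    by apply/funext => x; rewrite /rV_cons (@row_mxEr _ 1 1 n).
  by apply: measurableT_comp => //; exact: measurable_coord.
Qed.

Lemma measurable_rV_uncons : measurable_fun setT rV_uncons.
Proof.
apply: measurable_fun_pair; first exact: measurable_coord.
apply: measurable_fun_rVP => i.
under eq_fun do rewrite mxE.
exact: measurable_coord.
Qed.

Variable mu : {sigma_finite_measure set 'rV[R]_n -> \bar R}.

Definition lebesgue_rV_step : set 'rV[R]_n.+1 -> \bar R :=
  pushforward (@lebesgue_measure R \x mu)%E rV_cons.

Let step_pushforward : {measure set 'rV[R]_n.+1 -> \bar R} :=
  measure_function_pushforward__canonical__measure_function_Measure
    (@lebesgue_measure R \x mu)%E measurable_rV_cons.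

HB.instance Definition _ := Measure.copy lebesgue_rV_step step_pushforward.

(* Not derived from the library's sigma-finiteness of m1 \x m2: that canonical
   instance is shadowed by the one for products of subprobabilities. *)
Let step_sigma_finite : sigma_finite setT lebesgue_rV_step.
Proof.
have /sigma_finiteP[F [TF ndF Foo]] := sigma_finiteT (@lebesgue_measure R).
have /sigma_finiteP[G [TG ndG Goo]] := sigma_finiteT mu.
exists (fun k => rV_uncons @^-1` (F k `*` G k)).
  rewrite -preimage_bigcup (_ : \bigcup_k _ = setT) ?preimage_setT//.
  rewrite -subTset => -[x v] _.
  have [k _ Fkx] : (\bigcup_k F k) x by rewrite -TF.
  have [l _ Glv] : (\bigcup_k G k) v by rewrite -TG.
  exists (maxn k l) => //; split.
  - by move: x Fkx; exact/subsetPset/ndF/leq_maxl.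
  - by move: v Glv; exact/subsetPset/ndG/leq_maxr.
move=> k; have [mF Fk] := Foo k; have [mG Gk] := Goo k; split.
  rewrite -[X in measurable X]setTI.
  by apply: measurable_rV_uncons => //; exact: measurableX.
rewrite /lebesgue_rV_step /pushforward -comp_preimage.
rewrite (_ : _ \o _ = id); last by apply/funext => x /=; rewrite rV_consK.
by rewrite preimage_id product_measure1E// lte_mul_pinfty// ge0_fin_numE.
Qed.

HB.instance Definition _ := Measure_isSigmaFinite.Build _ _ _
  lebesgue_rV_step step_sigma_finite.

End lebesgue_rV_step.

(* N-dimensional Lebesgue measure, as the N-fold product of lebesgue_measure. *)
Fixpoint lebesgue_rV (R : realType) (n : nat) :
    {sigma_finite_measure set 'rV[R]_n -> \bar R} :=
  match n with
  | 0 => [the {sigma_finite_measure set 'rV[R]_0 -> \bar R} of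
           dirac (0 : 'rV[R]_0)]
  | n'.+1 => [the {sigma_finite_measure set 'rV[R]_n'.+1 -> \bar R} of
               lebesgue_rV_step (lebesgue_rV R n')]
  end.

Section euclidean_space.
Context {R : realType} {N : nat}.
Notation rV := 'rV[R]_N.
Notation mu := (lebesgue_rV R N).

(* The library's norm on 'rV[R]_N is the sup norm. *)
Definition eucl_norm (x : rV) : R := Num.sqrt (\sum_(i < N) x ord0 i ^+ 2).

Definition partial (i : 'I_N) (phi : rV -> R) : rV -> R :=
  'D_(delta_mx ord0 i) phi.

Fixpoint is_Ck (k : nat) (phi : rV -> R) : Prop :=
  match k with
  | 0 => continuous phi
  | k'.+1 => continuous phi /\
      forall i : 'I_N, (forall x, derivable phi x (delta_mx ord0 i)) /\
                       is_Ck k' (partial i phi)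
  end.

(* C_c^oo(R^N); real test functions suffice for complex weak derivatives. *)
Definition test_function (phi : rV -> R) : Prop :=
  (forall k, is_Ck k phi) /\
  exists M : R, forall x, M < eucl_norm x -> phi x = 0.

Definition L2R (f : rV -> R) : Prop :=
  measurable_fun setT f /\ finite_norm mu 2%:E f.

(* Complex-valued square-integrable functions. *)
Definition L2 (f : rV -> R[i]) : Prop :=
  L2R (@complex.Re R \o f) /\ L2R (@complex.Im R \o f).

Definition L2norm (f : rV -> R[i]) : \bar R :=
  Lnorm mu 2%:E (fun x => (normc (f x))%:E).

Definition continuousC (f : rV -> R[i]) : Prop :=
  continuous (@complex.Re R \o f) /\ continuous (@complex.Im R \o f).

Definition weak_partialR (i : 'I_N) (u g : rV -> R) : Prop :=
  forall phi, test_function phi ->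
    \int[mu]_x (u x * partial i phi x) = - \int[mu]_x (g x * phi x).

Definition weak_partial (i : 'I_N) (u g : rV -> R[i]) : Prop :=
  weak_partialR i (@complex.Re R \o u) (@complex.Re R \o g) /\
  weak_partialR i (@complex.Im R \o u) (@complex.Im R \o g).

(* u belongs to W^{2,2}(R^N), with weak gradient Du and weak Hessian D2u. *)
Definition W22 (u : rV -> R[i]) (Du : 'I_N -> rV -> R[i])
    (D2u : 'I_N -> 'I_N -> rV -> R[i]) : Prop :=
  [/\ L2 u,
      forall i, L2 (Du i) /\ weak_partial i u (Du i) &
      forall i j, L2 (D2u i j) /\ weak_partial j (Du i) (D2u i j)].

Definition coef_a (alpha : R) (x : rV) : R := 1 + eucl_norm x `^ alpha.

Definition coef_V (beta : R) (x : rV) : R := eucl_norm x `^ beta.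

Definition gradient_norm (Du : 'I_N -> rV -> R[i]) (x : rV) : R :=
  Num.sqrt (\sum_(i < N) normc (Du i x) ^+ 2).

Definition hessian_norm (D2u : 'I_N -> 'I_N -> rV -> R[i]) (x : rV) : R :=
  Num.sqrt (\sum_(i < N) \sum_(j < N) normc (D2u i j x) ^+ 2).

Definition laplacian (D2u : 'I_N -> 'I_N -> rV -> R[i]) (x : rV) : R[i] :=
  \sum_(i < N) D2u i i x.

(* u belongs to D(A_2), with weak gradient Du and weak Hessian D2u. *)
Definition A2_domain (alpha beta : R) (u : rV -> R[i])
    (Du : 'I_N -> rV -> R[i]) (D2u : 'I_N -> 'I_N -> rV -> R[i]) : Prop :=
  [/\ W22 u Du D2u,
      L2R (fun x => coef_a alpha x * hessian_norm D2u x),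
      L2R (fun x => coef_a alpha x `^ (1 / 2) * gradient_norm Du x) &
      L2 (fun x => real_complex R (coef_V beta x) * u x)].

(* The graph of A_2: u belongs to D(A_2) and A_2 u = f in L^2(R^N).  Weak
   derivatives are unique up to null sets, so their choice is irrelevant. *)
Definition A2_graph (alpha beta : R) (u f : rV -> R[i]) : Prop :=
  exists (Du : 'I_N -> rV -> R[i]) (D2u : 'I_N -> 'I_N -> rV -> R[i]),
    A2_domain alpha beta u Du D2u /\
    {ae mu, forall x,
      real_complex R (coef_a alpha x) * laplacian D2u x
        - real_complex R (coef_V beta x) * u x = f x}.

Definition normalized_eigenfunction (alpha beta : R) (lambda : R[i])
    (psi : rV -> R[i]) : Prop :=
  A2_graph alpha beta psi (fun x => lambda * psi x) /\ L2norm psi = 1%E.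

End euclidean_space.

(* Main.v *)
(* An eigenfunction [u] satisfies, weakly,
   [Lap u = (A + iB) u] with [A + iB = (V + lambda) / a].
   Multiplying [u] by a phase that makes [u x] real and positive gives a real
   weak solution below [|u|] which touches it at [x], so maximum principles
   for [|u|] only involve real functions.

   Averages of a continuous weakly subharmonic function against suitable
   kernels increase with the radius, whence a mean value inequality and a
   maximum principle which need no Sobolev regularity.  Maximising
   [(1 - |y - x|)^N |u y|] on a unit cube bounds [|u x|] by a power of the
   coefficients near [x], so an [L^2]-normalised [u] grows at most polynomially,
   with constants independent of [u].

   With [p = V / a] and [sigma = (beta - 2) / 4], the radial function
   [w = r^(-(N-1)/2) p^(-1/4) exp (- int sqrt p) exp (- r^(-sigma) / sigma)]
   is a supersolution for large [r], and so is [r^n].  Comparing [|u|] with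
   [M w + d |x|^n] outside a large ball and letting [d -> 0] gives
   [|u| <= M w]. *)
Require Import Defs.
From mathcomp Require Import all_boot all_order all_algebra.
From mathcomp Require Import all_classical all_reals all_analysis.
From mathcomp Require Import measurable_realfun complex.
From mathcomp Require Import ring lra.
Import Order.TTheory GRing.Theory Num.Theory.
Import numFieldTopology.Exports numFieldNormedType.Exports.
Import Normc.
Local Open Scope classical_set_scope.
Local Open Scope ring_scope.

(** Membership in D(A_2) gives second derivatives only as L^2 functions and no pointwise decay at
    infinity; both facts shape the proof. Dividing the equation by [a] produces continuous
    coefficients, hence a continuous right-hand side whose value at a touching point makes sense. A
    maximum principle on an exterior domain needs control at infinity: the a priori polynomial bound
    supplies it once [n] exceeds its degree, and its constant must not depend on [u] because [C] is
    fixed before [psi].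

    The powers r^(-(N-1)/2) and p^(-1/4) are those for which all terms of order sqrt p / r in w'' +
    (N-1)/r w' cancel. What remains is of order r^-2, besides the contribution of lambda / a, and
    has no favourable sign. The correction factor adds -2 sqrt p r^(-sigma-1) w. Since sqrt p
    r^(-sigma-1) = r^sigma / sqrt a and sqrt a <= 2 r for r >= 1, this dominates both remainders for
    large r, while the factor itself tends to 1. *)

(** * Cubes, Borel sets and Lebesgue measure *)

(** The closed sup-norm ball, written coordinatewise so that it splits as a product under [rV_cons].
    For negative [e] it is empty, except in dimension 0, where it is always the whole space. *)
Definition cube {R : realType} {n : nat} (x : 'rV[R]_n) (e : R) : set 'rV[R]_n :=
  [set y | forall i, `|y ord0 i - x ord0 i| <= e].

Lemma measurable_cube (R : realType) n (x : 'rV[R]_n) (e : R) :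
  measurable (cube x e).
Proof.
have -> : cube x e = \bigcap_(i in [set: 'I_n])
    ((fun y : 'rV[R]_n => y ord0 i) @^-1` `[x ord0 i - e, x ord0 i + e]).
  apply/seteqP; split=> [y H i _|y H i].
    by rewrite /= in_itv/= -ler_distl.
  by have := H i I; rewrite /= in_itv/= -ler_distl.
apply: fin_bigcap_measurable => // i _.
by rewrite -[X in measurable X]setTI; apply: measurable_coord.
Qed.

Lemma nbhs_cube (R : realType) n (x : 'rV[R]_n) (A : set 'rV[R]_n) :
  nbhs x A -> exists2 e : R, 0 < e & cube x e `<=` A.
Proof.
move=> /nbhs_ballP[e /= e0 He]; exists (e / 2); first exact: divr_gt0.
move=> y Hy; apply: He; split => // i j; rewrite (ord1 i) /ball/= distrC.
by apply: le_lt_trans (Hy j) _; lra.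
Qed.

Lemma cube_nbhs (R : realType) n (x : 'rV[R]_n) (e : R) :
  0 < e -> nbhs x (cube x e).
Proof.
move=> e0; apply/nbhs_ballP; exists e => // y [_ H] i.
by rewrite distrC ltW//; exact: H.
Qed.

(** The sigma-algebra is generated by the coordinates, so second countability enters: an open set is
    the countable union of the rational cubes that it contains. *)
Lemma open_measurable_rV (R : realType) n (U : set 'rV[R]_n) :
  open U -> measurable U.
Proof.
move=> oU.
pose q (z : 'rV[rat]_n) : 'rV[R]_n := \row_i ratr (z ord0 i).
have -> : U = \bigcup_(z in [set p : 'rV[rat]_n * rat |
    cube (q p.1) (ratr p.2) `<=` U]) cube (q z.1) (ratr z.2).
  apply/seteqP; split=> [x Ux|x [z zU]]; last exact: zU.
  have [e e0 He] : exists2 e : R, 0 < e & cube x e `<=` U.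
    by apply: nbhs_cube; exact: open_nbhs_nbhs.
  have e2 : 0 < e / 2 by exact: divr_gt0.
  (* A rational radius [r < e / 2] and a rational centre within [r] of [x]: the cube contains [x]
     and stays within [e] of it. *)
  have [r] := @rat_in_itvoo R 0 (e / 2) e2.
  rewrite in_itv/= => /andP[r0 re].
  have Hz i : {s : rat | `|ratr s - x ord0 i| <= ratr r}.
    apply: cid; have [|s] := @rat_in_itvoo R (x ord0 i - ratr r) (x ord0 i + ratr r).
      by rewrite ltrD2l gtrN.
    by rewrite in_itv/= => /andP[s1 s2]; exists s; rewrite ler_distl !ltW.
  exists (\row_i sval (Hz i), r).
    move=> y /= Hy; apply: He => i; have := Hy i; rewrite !mxE => {}Hy.
    rewrite (splitr e) (le_trans (ler_distD (ratr (sval (Hz i))) _ _))// lerD//.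
      by rewrite (le_trans Hy)// ltW.
    by case: (Hz i) => s /= /le_trans ->//; exact: ltW.
  by move=> i /=; rewrite !mxE distrC; case: (Hz i).
(* Numbers that code nothing are sent to a default cube, which is harmless because each term of the
   union below is guarded by the inclusion test. *)
have [f Hf] : exists f : nat -> 'rV[rat]_n * rat, forall y, exists k, f k = y.
  exists (fun k => odflt (0, 0) (unpickle k)) => y.
  by exists (pickle y); rewrite pickleK.
rewrite (_ : \bigcup_(z in _) _ = \bigcup_k
    (if `[< cube (q (f k).1) (ratr (f k).2) `<=` U >]
     then cube (q (f k).1) (ratr (f k).2) else set0)).
  by apply: bigcupT_measurable => k; case: ifPn => // _; exact: measurable_cube.
apply/seteqP; split=> [x [z /= zU zx]|x [k _]].
  have [k fk] := Hf z; exists k => //; rewrite fk.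
  by case: ifPn => // /asboolP.
by case: ifPn => // /asboolP H xk; exists (f k).
Qed.

Lemma continuous_measurable_rV (R : realType) n (f : 'rV[R]_n -> R) :
  continuous f -> measurable_fun setT f.
Proof.
move=> cf; apply: (measurability _ (RGenOInfty.measurableE R)).
move=> _ [_ [a ->] <-]; rewrite setTI; apply: open_measurable_rV.
by apply: open_comp => // x _; exact: cf.
Qed.

Lemma cube0 (R : realType) (x : 'rV[R]_0) e : cube x e = setT.
Proof. by apply/seteqP; split=> // y _ -[]. Qed.

Lemma rV_cons0 (R : realType) n (p : R * 'rV[R]_n) :
  rV_cons p ord0 ord0 = p.1.
Proof. by have /(congr1 fst) := rV_consK p. Qed.

Lemma rV_consS (R : realType) n (p : R * 'rV[R]_n) i :
  rV_cons p ord0 (lift ord0 i) = p.2 ord0 i.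
Proof.
by have /(congr1 (fun p : R * 'rV[R]_n => p.2 ord0 i)) := rV_consK p; rewrite mxE.
Qed.

Lemma rV_cons_preimage_cube (R : realType) n (x : 'rV[R]_n.+1) e :
  @rV_cons R n @^-1` cube x e =
  `[x ord0 ord0 - e, x ord0 ord0 + e] `*` cube (rV_uncons x).2 e.
Proof.
apply/seteqP; split => [[t v] H|[t v] /= [H1 H2] i].
  split.
    by have := H ord0; rewrite /= in_itv/= -ler_distl rV_cons0.
  by move=> i /=; rewrite mxE; have := H (lift ord0 i); rewrite rV_consS.
case: (unliftP ord0 i) => [j ->|->].
  by have := H2 j; rewrite mxE rV_consS.
by move: H1; rewrite in_itv/= -ler_distl rV_cons0.
Qed.

Lemma lebesgue_rV_cube (R : realType) n (x : 'rV[R]_n) (e : R) : 0 <= e ->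
  lebesgue_rV R n (cube x e) = ((e *+ 2) ^+ n)%:E.
Proof.
move=> e0; elim: n x => [|n IHn] x.
  by rewrite cube0 /= diracT expr0.
rewrite /= /lebesgue_rV_step /pushforward rV_cons_preimage_cube.
rewrite product_measure1E//; last exact: measurable_cube.
rewrite [X in (_ * X)%E]IHn [X in (X * _)%E](_ : _ = (e *+ 2)%:E) -?EFinM ?exprS//.
rewrite [LHS](lebesgue_measure_itv `[_, _]) /= lte_fin.
case: ltP => [_|h]; first by rewrite -EFinD; congr EFin; rewrite mulr2n; ring.
by congr EFin; rewrite mulr2n; move: h e0; lra.
Qed.

Lemma cube_compact (R : realType) n (x : 'rV[R]_n) e : compact (cube x e).
Proof.
have -> : cube x e = [set v : 'rV[R]_n | forall i,
    `[x ord0 i - e, x ord0 i + e]%classic (v ord0 i)].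
  by apply/seteqP; split=> y H i; have := H i; rewrite /= in_itv/= -ler_distl.
apply: (@rV_compact _ _ (fun i => `[x ord0 i - e, x ord0 i + e]%classic)) => i.
exact: segment_compact.
Qed.

Lemma continuous_bounded_cube (R : realType) n (f : 'rV[R]_n -> R) x e :
  continuous f -> exists2 K : R, 0 <= K & forall y, cube x e y -> `|f y| <= K.
Proof.
move=> cf; have [e0|e0] := leP 0 e; last first.
  (* For [e < 0] the cube is empty unless the dimension is 0, when it is a single point. *)
  case: n x f cf => [|n] x f cf.
    exists `|f 0| => // y _; suff -> : y = 0 by [].
    by apply/rowP => -[].
  exists 0 => // y /(_ ord0) H.
  by have := le_lt_trans (le_trans (normr_ge0 _) H) e0; rewrite ltxx.
have [||c _ Hc] := @compact_EVT_max _ R (fun y => `|f y|) (cube x e) _ (@cube_compact R n x e).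
- by exists x => i; rewrite subrr normr0.
- apply: continuous_subspaceT => y.
  by apply: (cvg_norm (cf y)).
by exists `|f c| => // y ye; apply: Hc; rewrite inE.
Qed.

(** * Functions supported in a cube, and integration by parts for them *)

Lemma integrable_finite_support d (T : measurableType d) (R : realType)
    (mu : {measure set T -> \bar R}) (A : set T) (f : T -> R) (K : R) :
  measurable A -> (mu A < +oo)%E -> measurable_fun setT f ->
  (forall y, `|f y| <= K) -> (forall y, ~ A y -> f y = 0) ->
  mu.-integrable setT (EFin \o f).
Proof.
move=> mA Aoo mf fK f0.
have -> : EFin \o f = (EFin \o f) \_ A.
  apply/funext => y; rewrite patchE; case: ifPn => // /negP yA /=.
  by rewrite f0// => Ay; apply: yA; rewrite inE.
apply/(integrable_mkcond _ mA); apply: measurable_bounded_integrable => //.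
  exact: measurable_funTS.
exists K; split; first exact: num_real.
by move=> M KM y _ /=; rewrite (le_trans (fK y))// ltW.
Qed.

Definition supported_in {R : realType} {n : nat} (x : 'rV[R]_n) (e : R)
  (f : 'rV[R]_n -> R) := forall y, ~ cube x e y -> f y = 0.

Lemma supported_bounded (R : realType) n (f : 'rV[R]_n -> R) x e :
  continuous f -> supported_in x e f -> exists2 K : R, 0 <= K & forall y, `|f y| <= K.
Proof.
move=> cf sf; have [K K0 HK] := @continuous_bounded_cube R n f x e cf.
exists K => // y; have [|ny] := pselect (cube x e y); first exact: HK.
by rewrite sf// normr0.
Qed.

Lemma cube_fin (R : realType) n (x : 'rV[R]_n) e :
  (lebesgue_rV R n (cube x e) < +oo)%E.
Proof.
have /le_lt_trans : (lebesgue_rV R n (cube x e) <= lebesgue_rV R n (cube x `|e|))%E.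
  apply: le_measure; rewrite ?inE; [exact: measurable_cube..|].
  by move=> y H i; rewrite (le_trans (H i))// ler_norm.
by apply; rewrite lebesgue_rV_cube// ltry.
Qed.

Lemma supported_integrable (R : realType) n (f : 'rV[R]_n -> R) x e :
  continuous f -> supported_in x e f ->
  (lebesgue_rV R n).-integrable setT (EFin \o f).
Proof.
move=> cf sf; have [K K0 HK] := supported_bounded _ _ _ _ _ cf sf.
apply: (integrable_finite_support _ _ _ _ (cube x e) f K) => //.
- exact: measurable_cube.
- exact: cube_fin.
- exact: continuous_measurable_rV.
Qed.

(** A directional derivative only sees the restriction to a line, so it can be moved between spaces:
    to slices of R^(n+1), and to the real line for the chain rule. *)
Lemma is_derive_line (R : realFieldType) (V V' : normedModType R) (F : V -> R) (G : V' -> R)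
    x w x' w' df :
  (forall h : R, F (h *: w + x) = G (h *: w' + x')) ->
  is_derive x w F df -> is_derive x' w' G df.
Proof.
move=> FG [dF <-].
have FG0 : F x = G x' by have := FG 0; rewrite !scale0r !add0r.
have E : (fun h : R => h^-1 *: ((G \o shift x') (h *: w') - G x')) =
         (fun h : R => h^-1 *: ((F \o shift x) (h *: w) - F x)).
  by apply/funext => h /=; rewrite FG FG0.
apply: DeriveDef; first by rewrite /derivable E.
by rewrite /derive E.
Qed.

Lemma int_derive0 (R : realType) (F F' : R -> R) (M : R) :
  (forall x : R, is_derive x 1 F (F' x)) -> continuous F' ->
  (forall x, M < `|x| -> F x = 0) -> (forall x, M < `|x| -> F' x = 0) ->
  \int[lebesgue_measure]_x F' x = 0.
Proof.
move=> dF cF' F0 F'0.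
(* [A] exceeds both [M] and 0: the interval is nondegenerate and [F] vanishes at its two ends. *)
pose A := `|M| + 1.
have A0 : 0 < A by rewrite ltr_pwDr.
have MA : M < A by rewrite /A (le_lt_trans (ler_norm M))// ltrDl.
have -> : \int[lebesgue_measure]_x F' x =
    \int[lebesgue_measure]_(x in `[- A, A]) F' x.
  rewrite [RHS]Rintegral_mkcond; apply: eq_Rintegral => x _.
  rewrite patchE; case: ifPn => // /negP xA; apply: F'0.
  apply: (lt_trans MA); rewrite ltNge; apply/negP => H; apply: xA.
  by rewrite inE /= in_itv/= -ler_norml.
rewrite /Rintegral (@continuous_FTC2 _ F' F).
- by rewrite !F0 ?normrN ?(gtr0_norm A0)// sube0.
- by rewrite (lt_trans _ A0)// oppr_lt0.
- exact: (continuous_subspaceT (f := F')).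
- have cF : continuous F.
    by move=> x; apply/differentiable_continuous/derivable1_diffP; case: (dF x).
  split; first by move=> x _; case: (dF x).
  + exact/cvg_at_right_filter/cF.
  + exact/cvg_at_left_filter/cF.
- by move=> x _; rewrite derive1E; case: (dF x).
Qed.

Lemma rV_cons_line0 (R : realType) n (h t : R) (v : 'rV[R]_n) :
  rV_cons (t + h, v) = h *: delta_mx ord0 ord0 + rV_cons (t, v).
Proof.
have E (A B : 'rV[R]_n.+1) k : (h *: A + B) ord0 k = h * A ord0 k + B ord0 k by rewrite !mxE.
apply/rowP => i; rewrite E [delta_mx _ _ _ _]mxE.
case: (unliftP ord0 i) => [j ->|->].
  by rewrite !rV_consS /= mulr0 add0r.
by rewrite !rV_cons0/= mulr1 addrC.
Qed.

Lemma rV_cons_lineS (R : realType) n (h t : R) (v : 'rV[R]_n) i :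
  rV_cons (t, h *: delta_mx ord0 i + v) =
  h *: delta_mx ord0 (lift ord0 i) + rV_cons (t, v).
Proof.
have E (A B : 'rV[R]_n.+1) k : (h *: A + B) ord0 k = h * A ord0 k + B ord0 k by rewrite !mxE.
apply/rowP => j; rewrite E [delta_mx _ _ _ _]mxE.
case: (unliftP ord0 j) => [k ->|->].
  by rewrite !rV_consS /= !mxE.
by rewrite !rV_cons0/= mulr0 add0r.
Qed.

Lemma continuous_rV_cons_r (R : realType) n (t : R) :
  continuous (fun v : 'rV[R]_n => rV_cons (t, v)).
Proof.
move=> v A /nbhs_cube[e e0 He].
apply: filterS (cube_nbhs _ _ v e e0) => w Hw; apply: He => i.
case: (unliftP ord0 i) => [k ->|->]; first by rewrite !rV_consS.
by rewrite !rV_cons0 subrr normr0 ltW.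
Qed.

Lemma continuous_rV_cons_l (R : realType) n (v : 'rV[R]_n) :
  continuous (fun t : R => rV_cons (t, v)).
Proof.
move=> t A /nbhs_cube[e e0 He].
apply/nbhs_ballP; exists e => // s; rewrite /ball/= => st; apply: He => i.
case: (unliftP ord0 i) => [k ->|->]; first by rewrite !rV_consS subrr normr0 ltW.
by rewrite !rV_cons0 distrC ltW.
Qed.

Lemma not_cube_coord (R : realType) n (x y : 'rV[R]_n) e i :
  e < `|y ord0 i - x ord0 i| -> ~ cube x e y.
Proof. by move=> + /(_ i); rewrite ltNge => /negP. Qed.

(** Fubini and induction on the dimension. If the derivative is along coordinate 0, that coordinate
    is integrated first and [int_derive0] applies to each line; otherwise coordinate 0 is frozen and
    the induction hypothesis applies to each slice. *)
Lemma int_partial0 (R : realType) n (F F' : 'rV[R]_n -> R) i (x : 'rV[R]_n) e :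
  (forall y, is_derive y (delta_mx ord0 i) F (F' y)) -> continuous F' ->
  supported_in x e F -> supported_in x e F' ->
  \int[lebesgue_rV R n]_y F' y = 0.
Proof.
elim: n F F' i x => [|n IHn] F F' i x dF cF' sF sF'; first by case: i dF.
have [K K0 F'K] := supported_bounded _ _ _ _ _ cF' sF'.
have mF' := continuous_measurable_rV _ _ _ cF'.
pose mu := (@lebesgue_measure R \x lebesgue_rV R n)%E.
have iF' : mu.-integrable setT (EFin \o (F' \o @rV_cons R n)).
  apply: (integrable_finite_support _ _ _ mu (@rV_cons R n @^-1` cube x e) _ K) => //.
  - rewrite -[X in measurable X]setTI; apply: measurable_rV_cons => //.
    exact: measurable_cube.
  - by have := cube_fin _ _ x e.
  - by apply: measurableT_comp => //; exact: measurable_rV_cons.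
  - by move=> y; exact: F'K.
  - by move=> y ny /=; exact: sF'.
rewrite /Rintegral.
have -> : (\int[lebesgue_rV R n.+1]_y (F' y)%:E =
    \int[mu]_p (F' (rV_cons p))%:E)%E.
  rewrite /= /lebesgue_rV_step integral_pushforward//.
  - exact: measurable_rV_cons.
  - exact/measurable_EFinP.
case: (unliftP ord0 i) => [j|] ij.
  rewrite -(integral12_prod_meas1 iF')/= integral0_eq// => t _.
  rewrite /fubini_F/=.
  have [K1|K1] := leP `|t - x ord0 ord0| e; last first.
    rewrite integral0_eq// => v _; rewrite sF'//.
    by apply: (not_cube_coord _ _ _ _ _ ord0); rewrite rV_cons0.
  have iG : (lebesgue_rV R n).-integrable setT (EFin \o (fun v => F' (rV_cons (t, v)))).
    apply: (supported_integrable _ _ _ (rV_uncons x).2 e).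
      by move=> v; apply: continuous_comp; [exact: continuous_rV_cons_r|exact: cF'].
    move=> v nv; apply: sF' => H; apply: nv => k /=.
    by have := H (lift ord0 k); rewrite rV_consS mxE.
  rewrite -[LHS]fineK; last exact: (integrable_fin_num _ iG).
  congr EFin; apply: (IHn (fun v => F (rV_cons (t, v))) _ j (rV_uncons x).2).
  - move=> v; apply: is_derive_line (dF (rV_cons (t, v))) => h.
    by rewrite rV_cons_lineS ij.
  - by move=> v; apply: continuous_comp; [exact: continuous_rV_cons_r|exact: cF'].
  - move=> v nv; apply: sF => H; apply: nv => k /=.
    by have := H (lift ord0 k); rewrite rV_consS mxE.
  - move=> v nv; apply: sF' => H; apply: nv => k /=.
    by have := H (lift ord0 k); rewrite rV_consS mxE.
rewrite -(integral21_prod_meas1 iF')/= integral0_eq// => v _.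
rewrite /fubini_G/=.
pose M := `|x ord0 ord0| + e.
have HM (s : R) : M < `|s| -> ~ cube x e (rV_cons (s, v)).
  move=> Ms; apply: (not_cube_coord _ _ _ _ _ ord0); rewrite rV_cons0/=.
  apply: lt_le_trans (lerB_dist _ _).
  by rewrite ltrBrDl.
have cs : continuous (fun s => F' (rV_cons (s, v))).
  by move=> s; apply: continuous_comp; [exact: continuous_rV_cons_l|exact: cF'].
have iG : lebesgue_measure.-integrable setT (EFin \o (fun s => F' (rV_cons (s, v)))).
  apply: (integrable_finite_support _ _ _ (@lebesgue_measure R) `[- M, M]%classic _ K) => //.
  - by rewrite [X in (X < _)%E](lebesgue_measure_itv `[_, _]); case: ifP => _; rewrite ltry.
  - exact: continuous_measurable_fun.
  - move=> s /= ns; apply/sF'/HM; rewrite ltNge; apply/negP.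
    by rewrite ler_norml => ?; apply: ns; rewrite in_itv.
rewrite -[LHS]fineK; last exact: (integrable_fin_num _ iG).
congr EFin; apply: (int_derive0 _ (fun s => F (rV_cons (s, v))) _ M) => //.
- move=> s; apply: is_derive_line (dF (rV_cons (s, v))) => h.
  by rewrite ij -rV_cons_line0 addrC [_%:A]mulr1.
- by move=> s /HM /sF.
- by move=> s /HM /sF'.
Qed.

(** * Differentiation rules for scalar functions *)

Section derivatives.
Context {R : realType} {V : normedModType R}.
Implicit Types (f g : V -> R) (x v : V).

Lemma is_derive_val f x v (a b : R) : is_derive x v f a -> a = b -> is_derive x v f b.
Proof. by move=> ? <-. Qed.

Lemma is_derive_const (c : R) x v : is_derive x v (fun=> c) 0.
Proof. exact: is_derive_cst. Qed.

Lemma is_derive_add f g x v a b : is_derive x v f a -> is_derive x v g b ->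
  is_derive x v (fun y => f y + g y) (a + b).
Proof. by move=> df dg; have := is_deriveD df dg. Qed.

Lemma is_derive_opp f x v a : is_derive x v f a ->
  is_derive x v (fun y => - f y) (- a).
Proof. by move=> df; have := is_deriveN df. Qed.

Lemma is_derive_sub f g x v a b : is_derive x v f a -> is_derive x v g b ->
  is_derive x v (fun y => f y - g y) (a - b).
Proof. by move=> df dg; have := is_deriveB df dg. Qed.

Lemma is_derive_mul f g x v a b : is_derive x v f a -> is_derive x v g b ->
  is_derive x v (fun y => f y * g y) (a * g x + f x * b).
Proof.
move=> df dg; apply: is_derive_val (is_deriveM df dg) _.
by rewrite addrC; congr (_ + _); exact: mulrC.
Qed.

Lemma is_derive_scale (c : R) f x v a : is_derive x v f a ->
  is_derive x v (fun y => c * f y) (c * a).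
Proof.
move=> df; apply: is_derive_val (is_derive_mul _ _ _ _ _ _ (is_derive_const c x v) df) _.
by rewrite mul0r add0r.
Qed.

Lemma is_derive_bigsum n (f : 'I_n -> V -> R) x v (a : 'I_n -> R) :
  (forall i, is_derive x v (f i) (a i)) ->
  is_derive x v (fun y => \sum_(i < n) f i y) (\sum_(i < n) a i).
Proof.
move=> df; have := @is_derive_sum _ _ _ n f x v a df.
by rewrite (_ : \sum_(i < n) f i = fun y => \sum_(i < n) f i y)//;
  apply/funext => y; rewrite fct_sumE.
Qed.

(** Restricting [f] to the line through [x] in direction [v] reduces this to the chain rule for
    functions of one real variable. *)
Lemma is_derive_compose (h : R -> R) f x v a b :
  is_derive x v f b -> is_derive (f x) 1 h a ->
  is_derive x v (fun y => h (f y)) (a * b).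
Proof.
move=> df dh.
have df' : is_derive (0 : R) 1 (fun t : R => f (t *: v + x)) b.
  apply: is_derive_line df => t.
  by rewrite addr0 [_%:A]mulr1.
have dh' : is_derive ((fun t : R => f (t *: v + x)) 0) 1 h a by rewrite scale0r add0r.
have := is_derive1_comp dh' df'.
apply: is_derive_line => t /=.
by rewrite addr0 [_%:A]mulr1.
Qed.

Lemma is_derive_inv f x v a : is_derive x v f a -> f x != 0 ->
  is_derive x v (fun y => (f y)^-1) (- a / f x ^+ 2).
Proof.
move=> df fx; have dV := @is_deriveV R id (f x) 1 1 fx (is_derive_id _ _).
apply: is_derive_val (is_derive_compose _ _ _ _ _ _ df dV) _.
by rewrite [_ *: _]mulr1 mulNr mulNr mulrC.
Qed.

Lemma is_derive_exprn f n x v a : is_derive x v f a ->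
  is_derive x v (fun y => f y ^+ n) (n%:R * f x ^+ n.-1 * a).
Proof.
move=> df; elim: n => [|n IHn].
  by rewrite !mul0r; exact: is_derive_const.
have -> : (fun y => f y ^+ n.+1) = (fun y => f y * f y ^+ n).
  by apply/funext => y; rewrite exprS.
apply: is_derive_val (is_derive_mul _ _ _ _ _ _ df IHn) _.
case: n {IHn} => [|n] /=; first by rewrite !expr0; ring.
by rewrite exprS -(natr1 n.+1); ring.
Qed.

End derivatives.

Lemma is_derive_continuous (R : realType) (f : R -> R) (x a : R) :
  is_derive x 1 f a -> {for x, continuous f}.
Proof. by move=> [df _]; apply/differentiable_continuous/derivable1_diffP. Qed.

Lemma is_derive_near (R : realType) (f g : R -> R) (x a : R) :
  (\near x, f x = g x) -> is_derive x 1 f a -> is_derive x 1 g a.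
Proof. by move=> fg; apply: near_eq_is_derive => //; exact: oner_neq0. Qed.

(** * Bump functions on the real line *)

(** Coefficient by coefficient, from y^i <= i! e^y; the extra 1 makes the constant positive. *)
Lemma poly_expRN_bounded (R : realType) (p : {poly R}) :
  exists2 C : R, 0 < C & forall y, 0 <= y -> `|p.[y]| * expR (- y) <= C.
Proof.
exists (\sum_(i < size p) `|p`_i| * i`!%:R + 1).
  by rewrite ltr_wpDl// sumr_ge0// => i _; apply: mulr_ge0.
move=> y y0; rewrite ler_wpDr// horner_coef.
apply: (@le_trans _ _ ((\sum_(i < size p) `|p`_i| * y ^+ i) * expR (- y))).
  rewrite ler_wpM2r ?expR_ge0// (le_trans (ler_norm_sum _ _ _))// ler_sum// => i _.
  by rewrite normrM normrX (ger0_norm y0).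
rewrite mulr_suml ler_sum// => i _.
rewrite -mulrA ler_wpM2l// expRN ler_pdivrMr ?expR_gt0//.
have f0 : 0 < i`!%:R :> R by rewrite ltr0n fact_gt0.
rewrite mulrC -ler_pdivrMr//; case: (i : nat) => [|k].
  by rewrite expr0 fact0 divr1 -expR0 ler_expR.
by apply: le_trans (expR_ge1Dxn k y0); rewrite lerDr ler01.
Qed.

(* For [p = 1] this is the standard bump; the family is closed under [d/dt]. *)
Definition bump {R : realType} (p : {poly R}) (t : R) : R :=
  if t < 1 then p.[(1 - t)^-1] * expR (- (1 - t)^-1) else 0.

(** With z = 1 / (1 - t) one has dz/dt = z^2, so p(z) e^(-z) has derivative (p'(z) - p(z)) z^2
    e^(-z). *)
Definition bump_deriv {R : realType} (p : {poly R}) : {poly R} :=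
  (p^`() - p) * 'X^2.

Lemma bump_ge1 (R : realType) (p : {poly R}) t : 1 <= t -> bump p t = 0.
Proof. by move=> t1; rewrite /bump ltNge t1. Qed.

Lemma bump_bounded (R : realType) (p : {poly R}) :
  exists2 C : R, 0 <= C & forall t, `|bump p t| <= C.
Proof.
have [C C0 HC] := poly_expRN_bounded _ p.
exists C => [|t]; first exact: ltW.
rewrite /bump; case: ifPn => [t1|_]; last by rewrite normr0 ltW.
rewrite normrM (ger0_norm (expR_ge0 _)); apply: HC.
by rewrite invr_ge0 subr_ge0 ltW.
Qed.

Lemma is_derive_bump (R : realType) (p : {poly R}) (t : R) :
  is_derive t 1 (bump p) (bump (bump_deriv p) t).
Proof.
have [t1|t1|->] := ltgtP t 1.
- have nz : 1 - t != 0 by rewrite subr_eq0 eq_sym lt_eqF.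
  apply: (is_derive_near _ (fun t => p.[(1 - t)^-1] * expR (- (1 - t)^-1))).
    near=> s; rewrite /bump ifT//.
    by near: s; exact: lt_nbhsl.
  have dV : is_derive t 1 (fun s : R => (1 - s)^-1) ((1 - t)^-1 ^+ 2).
    have d1 : is_derive t 1 (fun s : R => 1 - s) (-1).
      apply: is_derive_val (is_derive_sub _ _ _ _ _ _ (is_derive_const 1 _ _) (is_derive_id _ _)) _.
      by rewrite sub0r.
    by apply: is_derive_val (is_derive_inv _ _ _ _ d1 nz) _; rewrite opprK mul1r exprVn.
  have dp := is_derive_compose _ _ _ _ _ _ dV (is_derive_poly p (1 - t)^-1).
  have de := is_derive_compose _ _ _ _ _ _ (is_derive_opp _ _ _ _ dV) (is_derive_expR _).
  apply: is_derive_val (is_derive_mul _ _ _ _ _ _ dp de) _.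
  rewrite /bump t1 /bump_deriv !hornerE /=; ring.
- apply: (is_derive_near _ (fun=> 0)).
    near=> s; rewrite bump_ge1// ltW//.
    by near: s; exact: lt_nbhsr.
  by rewrite bump_ge1 ?ltW//; exact: is_derive_const.
- rewrite bump_ge1//.
  (* At t = 1 the quotient for h < 0 is y |p(y)| e^(-y) in absolute value, where y = -1/h. Bounding
     y^2 |p(y)| e^(-y) by [C] leaves C / y = C |h|, which tends to 0. *)
  have [C C0 HC] := poly_expRN_bounded _ (p * 'X^2).
  have H : (fun h : R => h^-1 *: ((bump p \o shift 1) (h *: 1) - bump p 1)) @ 0^' --> (0 : R).
    apply/cvgrPdist_le => e e0; near=> h.
    rewrite (bump_ge1 _ _ 1)// subr0 /= sub0r normrN [h%:A]mulr1 normrZ.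
    have [h0|h0] := leP 0 h.
      by rewrite bump_ge1 ?lerDr// normr0 mulr0 ltW.
    have h1 : h + 1 < 1 by rewrite -ltrBrDr subrr.
    rewrite /bump h1 (_ : 1 - (h + 1) = - h); last by ring.
    set y := (- h)^-1.
    have y0 : 0 < y by rewrite invr_gt0 oppr_gt0.
    have -> : `|h^-1| = y by rewrite normfV ltr0_norm.
    apply: le_trans (_ : C * `|h| <= e).
      have -> : `|h| = y^-1 by rewrite invrK ltr0_norm.
      rewrite ler_pdivlMr// normrM (ger0_norm (expR_ge0 _)).
      apply: le_trans (HC _ (ltW y0)).
      rewrite hornerM hornerXn normrM (ger0_norm (exprn_ge0 2 (ltW y0))).
      by rewrite le_eqVlt; apply/orP; left; apply/eqP; ring.
    rewrite mulrC -ler_pdivlMr//.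
    by near: h; apply: dnbhs0_le; rewrite divr_gt0.
  by apply: DeriveDef; [apply/cvg_ex; exists 0|apply: cvg_lim].
Unshelve. all: by end_near. Qed.

Lemma continuous_bump (R : realType) (p : {poly R}) : continuous (bump p).
Proof. by move=> t; apply: is_derive_continuous (is_derive_bump _ p t). Qed.

(** * Smooth radial bumps *)

Section radial.
Context {R : realType} {N : nat}.
Notation rV := 'rV[R]_N.
Notation e_ i := (delta_mx ord0 i : rV).

Implicit Types (x y : rV).

(** The squared distance, a polynomial in the coordinates and therefore smooth even at [x], unlike
    the distance. *)
Definition rad (x y : rV) : R := \sum_(i < N) (y ord0 i - x ord0 i) ^+ 2.

Definition radial_bump (p : {poly R}) (x : rV) (r : R) (y : rV) : R :=
  bump p (rad x y / r ^+ 2).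

Lemma rad_ge0 x y : 0 <= rad x y.
Proof. by apply: sumr_ge0 => i _; exact: sqr_ge0. Qed.

Lemma radxx x : rad x x = 0.
Proof. by rewrite /rad big1// => i _; rewrite subrr expr0n. Qed.

Lemma sqr_coord_le_rad x y i : (y ord0 i - x ord0 i) ^+ 2 <= rad x y.
Proof.
rewrite /rad (bigD1 i)//= lerDl; apply: sumr_ge0 => j _; exact: sqr_ge0.
Qed.

Lemma rad_le_cube x y r : 0 <= r -> rad x y <= r ^+ 2 -> cube x r y.
Proof.
move=> r0 H i; rewrite -ler_sqr ?nnegrE// real_normK ?num_real//.
exact: le_trans (sqr_coord_le_rad x y i) H.
Qed.

Lemma cube_rad x y r : cube x r y -> rad x y <= N%:R * r ^+ 2.
Proof.
move=> H; rewrite /rad mulr_natl -[X in _ *+ X]card_ord -sumr_const.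
apply: ler_sum => i _; have := H i => Hi.
by rewrite -real_normK ?num_real// ler_sqr ?nnegrE// (le_trans _ Hi).
Qed.

Lemma continuous_coord i : continuous (fun y : rV => y ord0 i).
Proof. by move=> y; exact: coord_continuous. Qed.

Lemma continuous_add (f g : rV -> R) : continuous f -> continuous g ->
  continuous (fun y => f y + g y).
Proof. by move=> cf cg y; exact: (continuousD (cf y) (cg y)). Qed.

Lemma continuous_mul (f g : rV -> R) : continuous f -> continuous g ->
  continuous (fun y => f y * g y).
Proof. by move=> cf cg y; exact: (continuousM (cf y) (cg y)). Qed.

Lemma continuous_opp (f : rV -> R) : continuous f -> continuous (fun y => - f y).
Proof. by move=> cf y; exact: (continuousN (cf y)). Qed.

Lemma continuous_const (c : R) : continuous (fun _ : rV => c).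
Proof. by move=> y; exact: cst_continuous. Qed.

Lemma continuous_sum n (f : 'I_n -> rV -> R) : (forall i, continuous (f i)) ->
  continuous (fun y => \sum_(i < n) f i y).
Proof.
move=> cf; elim: n f cf => [|n IHn] f cf.
  by under eq_fun do rewrite big_ord0; exact: continuous_const.
under eq_fun do rewrite big_ord_recr/=.
by apply: continuous_add; [exact: IHn|exact: cf].
Qed.

Lemma continuous_diff_coord x i : continuous (fun y : rV => y ord0 i - x ord0 i).
Proof. exact: (continuous_add _ _ (continuous_coord i) (continuous_const _)). Qed.

Lemma continuous_rad x : continuous (rad x).
Proof.
apply: continuous_sum => i; under eq_fun do rewrite expr2.
by apply: continuous_mul; exact: continuous_diff_coord.
Qed.

Lemma continuous_radial_bump p x r : continuous (radial_bump p x r).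
Proof.
move=> y; apply: (@continuous_comp _ _ _ (fun y => rad x y / r ^+ 2) (bump p)).
  by apply: continuous_mul; [exact: continuous_rad|exact: continuous_const].
exact: continuous_bump.
Qed.

Lemma radial_bump0 p x r y : 0 < r -> r ^+ 2 <= rad x y -> radial_bump p x r y = 0.
Proof.
move=> r0 H; rewrite /radial_bump bump_ge1// ler_pdivlMr ?exprn_gt0//.
by rewrite mul1r.
Qed.

Lemma radial_bump_supported p x r : 0 < r -> supported_in x r (radial_bump p x r).
Proof.
move=> r0 y ny; apply: radial_bump0 => //; rewrite leNgt; apply/negP => H.
by apply: ny; apply: rad_le_cube; exact: ltW.
Qed.

Lemma is_derive_coord (y : rV) i j :
  is_derive y (e_ j) (fun y : rV => y ord0 i) ((i == j)%:R : R).
Proof.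
have d : is_derive (0 : R) 1 (fun h : R => h * (i == j)%:R + y ord0 i) ((i == j)%:R : R).
  apply: is_derive_val (is_derive_add _ _ _ _ _ _
    (is_derive_mul _ _ _ _ _ _ (is_derive_id _ _) (is_derive_const _ _ _))
    (is_derive_const _ _ _)) _.
  by rewrite mul1r mulr0 !addr0.
by apply: is_derive_line d => h; rewrite !mxE/= addr0 [_%:A]mulr1.
Qed.

Lemma is_derive_diff_coord (x y : rV) i j :
  is_derive y (e_ j) (fun y : rV => y ord0 i - x ord0 i) ((i == j)%:R : R).
Proof.
apply: is_derive_val (is_derive_sub _ _ _ _ _ _ (is_derive_coord y i j) (is_derive_const _ _ _)) _.
by rewrite subr0.
Qed.

Lemma is_derive_rad x y j :
  is_derive y (e_ j) (rad x) (2 * (y ord0 j - x ord0 j)).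
Proof.
apply: is_derive_val (is_derive_bigsum _ _ _ _ _ (fun i =>
  is_derive_exprn _ 2 _ _ _ (is_derive_diff_coord x y i j))) _.
rewrite (bigD1 j)//= eqxx mulr1 big1 ?addr0 ?expr1// => i ij.
by rewrite (negbTE ij) mulr0.
Qed.

Lemma is_derive_radial_bump p x r y j :
  is_derive y (e_ j) (radial_bump p x r)
    (2 / r ^+ 2 * (y ord0 j - x ord0 j) * radial_bump (bump_deriv p) x r y).
Proof.
have d := is_derive_mul _ _ _ _ _ _ (is_derive_rad x y j) (is_derive_const (r ^+ 2)^-1 y (e_ j)).
apply: is_derive_val (is_derive_compose _ _ _ _ _ _ d (is_derive_bump _ p _)) _.
by rewrite /radial_bump; ring.
Qed.

Lemma is_CkS k (f : rV -> R) (f' : 'I_N -> rV -> R) : continuous f ->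
  (forall i y, is_derive y (e_ i) f (f' i y)) -> (forall i, is_Ck k (f' i)) ->
  is_Ck k.+1 f.
Proof.
move=> cf df Cf'; split => // i; split=> [y|]; first by case: (df i y).
suff -> : partial i f = f' i by exact: Cf'.
by apply/funext => y; case: (df i y).
Qed.

Lemma is_Ck_continuous k (f : rV -> R) : is_Ck k f -> continuous f.
Proof. by case: k => [|k] // []. Qed.

Lemma is_CkW k (f : rV -> R) : is_Ck k.+1 f -> is_Ck k f.
Proof.
elim: k f => [|k IHk] f [cf H]//; split => // i.
by have [df Cf'] := H i; split => //; exact: IHk.
Qed.

Lemma is_Ck_derive k (f : rV -> R) : is_Ck k.+1 f ->
  forall i y, is_derive y (e_ i) f (partial i f y).
Proof. by move=> [_ H] i y; apply: DeriveDef => //; have [] := H i. Qed.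

Lemma is_Ck_const k (c : R) : is_Ck k (fun _ : rV => c).
Proof.
elim: k c => [|k IHk] c; first exact: continuous_const.
apply: (is_CkS _ _ (fun _ _ => 0)) => //; exact: continuous_const.
Qed.

Lemma is_Ck_add k (f g : rV -> R) : is_Ck k f -> is_Ck k g ->
  is_Ck k (fun y => f y + g y).
Proof.
elim: k f g => [|k IHk] f g Cf Cg; first exact: continuous_add.
apply: (is_CkS _ _ (fun i y => partial i f y + partial i g y)).
- by apply: continuous_add; [apply: is_Ck_continuous Cf|apply: is_Ck_continuous Cg].
- by move=> i y; apply: is_derive_add; exact: (is_Ck_derive k).
- move=> i; apply: IHk; first by case: Cf => _ /(_ i)[].
  by case: Cg => _ /(_ i)[].
Qed.

Lemma is_Ck_mul k (f g : rV -> R) : is_Ck k f -> is_Ck k g ->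
  is_Ck k (fun y => f y * g y).
Proof.
elim: k f g => [|k IHk] f g Cf Cg; first exact: continuous_mul.
apply: (is_CkS _ _ (fun i y => partial i f y * g y + f y * partial i g y)).
- by apply: continuous_mul; [apply: is_Ck_continuous Cf|apply: is_Ck_continuous Cg].
- by move=> i y; apply: is_derive_mul; exact: (is_Ck_derive k).
- move=> i; apply: is_Ck_add; apply: IHk; try exact: is_CkW.
    by case: Cf => _ /(_ i)[].
  by case: Cg => _ /(_ i)[].
Qed.

Lemma is_Ck_diff_coord k (x : rV) i : is_Ck k (fun y : rV => y ord0 i - x ord0 i).
Proof.
case: k => [|k]; first exact: continuous_diff_coord.
apply: (is_CkS _ _ (fun j _ => (i == j)%:R)); first exact: continuous_diff_coord.
- by move=> j y; exact: is_derive_diff_coord.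
- by move=> j; exact: is_Ck_const.
Qed.

Lemma is_Ck_radial_bump k p x r : is_Ck k (radial_bump p x r).
Proof.
elim: k p => [|k IHk] p; first exact: continuous_radial_bump.
apply: (is_CkS _ _ (fun i y => 2 / r ^+ 2 * (y ord0 i - x ord0 i) *
  radial_bump (bump_deriv p) x r y)); first exact: continuous_radial_bump.
- by move=> i y; exact: is_derive_radial_bump.
- move=> i; apply: is_Ck_mul => //.
  by apply: is_Ck_mul; [exact: is_Ck_const|exact: is_Ck_diff_coord].
Qed.

Lemma eucl_normE (y : rV) : eucl_norm y = Num.sqrt (rad 0 y).
Proof. by congr Num.sqrt; apply: eq_bigr => i _; rewrite mxE subr0. Qed.

Lemma test_function_radial_bump p x r : 0 < r -> test_function (radial_bump p x r).
Proof.
move=> r0; split; first by move=> k; exact: is_Ck_radial_bump.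
pose M := \sum_(i < N) (`|x ord0 i| + r).
exists (Num.sqrt (N%:R * M ^+ 2)) => y; rewrite eucl_normE => H.
apply: radial_bump_supported => // cy.
have c0 : cube 0 M y.
  move=> i; rewrite mxE subr0.
  have /(le_trans _) : `|x ord0 i| + r <= M.
    rewrite /M (bigD1 i)//= lerDl sumr_ge0// => j _.
    by rewrite addr_ge0// ltW.
  apply; rewrite -[y ord0 i](subrK (x ord0 i)) addrC.
  by rewrite (le_trans (ler_normD _ _))// lerD2l; exact: cy.
by have := lt_le_trans H (ler_wsqrtr (cube_rad _ _ _ c0)); rewrite ltxx.
Qed.

Lemma partial_radial_bump p x r i :
  partial i (radial_bump p x r) =
  fun y => 2 / r ^+ 2 * (y ord0 i - x ord0 i) * radial_bump (bump_deriv p) x r y.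
Proof.
by apply/funext => y; case: (is_derive_radial_bump p x r y i).
Qed.

Lemma is_derive_partial (f : rV -> R) i : test_function f ->
  forall y, is_derive y (e_ i) f (partial i f y).
Proof. by move=> [/(_ 1%N) H _] y; exact: is_Ck_derive H i y. Qed.

(** The exterior of a closed ball is open, so the derivative vanishes there too, with the same
    radius. This allows a weak derivative to be tested against a partial derivative of a bump. *)
Lemma test_function_partial (f : rV -> R) i : test_function f ->
  test_function (partial i f).
Proof.
move=> [Cf [M HM]]; split.
  by move=> k; have [_ /(_ i)[]] := Cf k.+1.
exists M => y My.
have cn : {for y, continuous (@eucl_norm R N)}.
  rewrite (_ : @eucl_norm R N = Num.sqrt \o rad 0).
    by apply: continuous_comp; [exact: continuous_rad|exact: sqrt_continuous].
  by apply/funext => z; exact: eucl_normE.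
have f0 : \near y, (fun=> 0 : R) y = f y.
  by near=> z; rewrite HM//; near: z; exact: (cvgr_gt _ cn).
by have [] := near_eq_is_derive f0 (is_derive_const 0 y (e_ i)).
Unshelve. all: by end_near. Qed.

End radial.

Lemma Rintegral_sum d (T : measurableType d) (R : realType)
    (nu : {measure set T -> \bar R}) n (f : 'I_n -> T -> R) :
  (forall i, nu.-integrable setT (EFin \o f i)) ->
  nu.-integrable setT (EFin \o (fun y => \sum_(i < n) f i y)) /\
  \int[nu]_y (\sum_(i < n) f i y) = \sum_(i < n) \int[nu]_y f i y.
Proof.
elim: n f => [|n IHn] f fi.
  split; last by under eq_Rintegral do rewrite big_ord0; rewrite Rintegral_cst// mul0r big_ord0.
  rewrite (_ : _ \o _ = cst 0%E); first exact: integrable0.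
  by apply/funext => y /=; rewrite big_ord0.
have [ii IH] := IHn _ (fun i => fi (widen_ord (leqnSn n) i)).
split.
  have := integrableD measurableT ii (fi ord_max).
  apply: eq_ind; congr (_.-integrable _ _); apply/funext => y /=.
  by rewrite big_ord_recr/= EFinD.
under eq_Rintegral do rewrite big_ord_recr/=.
by rewrite RintegralD// IH big_ord_recr.
Qed.

(** * The weak Laplace equation and its explicit solutions *)

Section laplacian.
Context {R : realType} {N : nat}.
Notation rV := 'rV[R]_N.
Notation mu := (lebesgue_rV R N).
Notation e_ i := (delta_mx ord0 i : rV).
Implicit Types (x y : rV) (r : R).

(** The Laplacian of F(s) with s = |y - x|^2 / r^2 and F the standard bump, that is 2/r^2 (N F'(s) +
    2 s F''(s)). *)
Definition lap_bump x r y : R :=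
  2 / r ^+ 2 * (N%:R * bump (bump_deriv 1) (rad x y / r ^+ 2) +
    2 * (rad x y / r ^+ 2) * bump (bump_deriv (bump_deriv 1)) (rad x y / r ^+ 2)).

Definition partial2_bump x r i y : R :=
  2 / r ^+ 2 * (radial_bump (bump_deriv 1) x r y +
  2 / r ^+ 2 * (y ord0 i - x ord0 i) ^+ 2 *
     radial_bump (bump_deriv (bump_deriv 1)) x r y).

Lemma is_derive_partial_bump x r i y :
  is_derive y (e_ i) (partial i (radial_bump 1 x r)) (partial2_bump x r i y).
Proof.
rewrite partial_radial_bump.
have d := is_derive_mul _ _ _ _ _ _
  (is_derive_scale (2 / r ^+ 2) _ _ _ _ (is_derive_diff_coord x y i i))
  (is_derive_radial_bump (bump_deriv 1) x r y i).
by apply: is_derive_val d _; rewrite /partial2_bump eqxx mulr1; ring.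
Qed.

Lemma sum_partial2_bump x r y : \sum_(i < N) partial2_bump x r i y = lap_bump x r y.
Proof.
rewrite /partial2_bump -mulr_sumr /lap_bump; congr (_ * _).
rewrite big_split/= sumr_const card_ord; congr (_ + _); first by rewrite mulr_natl.
by rewrite -mulr_suml -mulr_sumr /radial_bump /rad; ring.
Qed.

Lemma continuous_partial2_bump x r i : continuous (partial2_bump x r i).
Proof.
apply: continuous_mul; first exact: continuous_const.
apply: continuous_add; first exact: continuous_radial_bump.
apply: continuous_mul; last exact: continuous_radial_bump.
apply: continuous_mul; first exact: continuous_const.
under eq_fun do rewrite expr2.
by apply: continuous_mul; exact: continuous_diff_coord.
Qed.

Lemma continuous_lap_bump x r : continuous (lap_bump x r).
Proof.
rewrite (_ : lap_bump x r = fun y => \sum_(i < N) partial2_bump x r i y).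
  by apply: continuous_sum => i; exact: continuous_partial2_bump.
by apply/funext => y; rewrite sum_partial2_bump.
Qed.

Lemma lap_bump_supported x r : 0 < r -> supported_in x r (lap_bump x r).
Proof.
move=> r0 y ny; rewrite -sum_partial2_bump big1// => i _.
by rewrite /partial2_bump !radial_bump_supported// !mulr0 addr0 mulr0.
Qed.

Lemma supported_mul (f g : rV -> R) x r : supported_in x r g ->
  supported_in x r (fun y => f y * g y).
Proof. by move=> sg y ny; rewrite sg// mulr0. Qed.

Lemma supported_integrable_mul (f g : rV -> R) x r : continuous f -> continuous g ->
  supported_in x r g -> mu.-integrable setT (EFin \o (fun y => f y * g y)).
Proof.
move=> cf cg sg; apply: (supported_integrable _ _ _ x r).
  exact: continuous_mul.
exact: supported_mul.
Qed.

(* [v] is a weak solution of [Lap v = f], tested against the bumps only. *)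
Definition weak_laplacian (v f : rV -> R) : Prop :=
  [/\ continuous v, continuous f & forall x r, 0 < r ->
    \int[mu]_y (v y * lap_bump x r y) = \int[mu]_y (f y * radial_bump 1 x r y)].

Lemma weak_laplacian_lin (a b : R) v f w g :
  weak_laplacian v f -> weak_laplacian w g ->
  weak_laplacian (fun y => a * v y + b * w y) (fun y => a * f y + b * g y).
Proof.
move=> [cv cf vf] [cw cg wg]; split.
- by apply: continuous_add; apply: continuous_mul => //; exact: continuous_const.
- by apply: continuous_add; apply: continuous_mul => //; exact: continuous_const.
move=> x r r0.
have H (u1 u2 h : rV -> R) : continuous u1 -> continuous u2 -> continuous h ->
    supported_in x r h -> \int[mu]_y ((a * u1 y + b * u2 y) * h y) =
      a * \int[mu]_y (u1 y * h y) + b * \int[mu]_y (u2 y * h y).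
  move=> c1 c2 ch sh.
  under eq_Rintegral do rewrite mulrDl -!mulrA.
  have i1 := supported_integrable_mul u1 h x r c1 ch sh.
  have i2 := supported_integrable_mul u2 h x r c2 ch sh.
  rewrite RintegralD ?RintegralZl//.
  + exact: (integrableZl measurableT a i1).
  + exact: (integrableZl measurableT b i2).
rewrite !H//; first by rewrite vf// wg.
- exact: continuous_radial_bump.
- exact: radial_bump_supported.
- exact: continuous_lap_bump.
- exact: lap_bump_supported.
Qed.

(** With b the bump, w d_i^2 b - b d_i^2 w is the i-th derivative of the compactly supported w d_i b
    - b d_i w, so its integral vanishes. *)
Lemma weak_laplacian_C2 (w : rV -> R) (w1 w2 : 'I_N -> rV -> R) :
  (forall i y, is_derive y (e_ i) w (w1 i y)) ->
  (forall i y, is_derive y (e_ i) (w1 i) (w2 i y)) ->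
  continuous w -> (forall i, continuous (w2 i)) ->
  weak_laplacian w (fun y => \sum_(i < N) w2 i y).
Proof.
move=> dw dw1 cw cw2; split => //; first exact: continuous_sum.
move=> x r r0.
have H i : \int[mu]_y (w y * partial2_bump x r i y - w2 i y * radial_bump 1 x r y) = 0.
  apply: (@int_partial0 R N (fun y => w y * partial i (radial_bump 1 x r) y -
    w1 i y * radial_bump 1 x r y) _ i x r).
  - move=> y; have d1 := is_derive_mul _ _ _ _ _ _ (dw i y) (is_derive_partial_bump x r i y).
    have d2 := is_derive_mul _ _ _ _ _ _ (dw1 i y)
      (is_derive_partial _ i (test_function_radial_bump 1 x r r0) y).
    by apply: is_derive_val (is_derive_sub _ _ _ _ _ _ d1 d2) _; ring.
  - apply: (continuous_add _ (fun y => - (w2 i y * radial_bump 1 x r y))).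
      by apply: continuous_mul => //; exact: continuous_partial2_bump.
    apply: continuous_opp.
    by apply: continuous_mul => //; exact: continuous_radial_bump.
  - move=> y ny; rewrite partial_radial_bump/= !radial_bump_supported//.
    by rewrite !mulr0 subrr.
  - move=> y ny; rewrite /partial2_bump !radial_bump_supported//.
    by rewrite !(mulr0, addr0) subrr.
have i1 i : mu.-integrable setT (EFin \o (fun y => w y * partial2_bump x r i y)).
  apply: (supported_integrable_mul _ _ x r) => //; first exact: continuous_partial2_bump.
  move=> y ny; rewrite /partial2_bump !radial_bump_supported//.
  by rewrite !(mulr0, addr0).
have i2 i : mu.-integrable setT (EFin \o (fun y => w2 i y * radial_bump 1 x r y)).
  apply: (supported_integrable_mul _ _ x r) => //; first exact: continuous_radial_bump.
  exact: radial_bump_supported.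
transitivity (\sum_(i < N) \int[mu]_y (w y * partial2_bump x r i y)).
  rewrite -(Rintegral_sum _ _ _ _ _ _ i1).2; apply: eq_Rintegral => y _.
  by rewrite -mulr_sumr sum_partial2_bump.
transitivity (\sum_(i < N) \int[mu]_y (w2 i y * radial_bump 1 x r y)).
  by apply: eq_bigr => i _; apply/eqP; rewrite -subr_eq0 -RintegralB// H.
rewrite -(Rintegral_sum _ _ _ _ _ _ i2).2; apply: eq_Rintegral => y _.
by rewrite -mulr_suml.
Qed.

(** These polynomials provide the explicit functions of the mean value and touching arguments:
    constants, the squared distance with Laplacian 2N, and the touching polynomial of
    [weak_laplacian_radial_touch]. *)
Lemma weak_laplacian_rad (T : {poly R}) x :
  weak_laplacian (fun y => T.[rad x y])
    (fun y => 4 * rad x y * T^`()^`().[rad x y] + 2 * N%:R * T^`().[rad x y]).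
Proof.
have cp (p : {poly R}) : continuous (fun y => p.[rad x y]).
  move=> y; apply: (@continuous_comp _ _ _ (rad x) (horner p)); first exact: continuous_rad.
  exact: continuous_horner.
have -> : (fun y => 4 * rad x y * T^`()^`().[rad x y] + 2 * N%:R * T^`().[rad x y]) =
  (fun y => \sum_(i < N) (4 * (y ord0 i - x ord0 i) ^+ 2 * T^`()^`().[rad x y] +
     2 * T^`().[rad x y])).
  apply/funext => y; rewrite big_split/= sumr_const card_ord -mulr_suml -mulr_sumr.
  by rewrite /rad -[_ *+ N]mulr_natl; ring.
apply: (weak_laplacian_C2 _ (fun i y => T^`().[rad x y] * (2 * (y ord0 i - x ord0 i)))).
- by move=> i y; apply: is_derive_compose (is_derive_rad x y i) (is_derive_poly _ _).
- move=> i y.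
  have d := is_derive_mul _ _ _ _ _ _
    (is_derive_compose _ _ _ _ _ _ (is_derive_rad x y i) (is_derive_poly T^`() _))
    (is_derive_scale 2 _ _ _ _ (is_derive_diff_coord x y i i)).
  by apply: is_derive_val d _; rewrite eqxx !mulr1; ring.
- exact: cp.
- move=> i; apply: continuous_add; apply: continuous_mul => //; last exact: continuous_const.
  apply: continuous_mul; first exact: continuous_const.
  under eq_fun do rewrite expr2.
  by apply: continuous_mul; exact: continuous_diff_coord.
Qed.

End laplacian.

(** * Mean values of weakly subharmonic functions *)

Section means.
Context {R : realType} {N : nat}.
Notation rV := 'rV[R]_N.
Notation mu := (lebesgue_rV R N).
Implicit Types (x y : rV) (r : R).

(* An averaging kernel with [d/dr kernel = r^(1-N)/2 * Lap (bump)]: averages of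
   weakly subharmonic functions are nondecreasing in [r]. *)
Definition mean_kernel x r y : R := r ^- N * radial_bump 'X^2 x r y.

Definition mean (v : rV -> R) x r : R := \int[mu]_y (v y * mean_kernel x r y).

Lemma bump_deriv_one : bump_deriv 1 = - 'X^2 :> {poly R}.
Proof. by rewrite /bump_deriv -[1]polyC1 derivC sub0r mulN1r. Qed.

Lemma bumpN p t : bump (- p) t = - bump p t :> R.
Proof. by rewrite /bump; case: ifP => _; rewrite ?oppr0// hornerN mulNr. Qed.

Lemma bump_deriv1 t : bump (bump_deriv 1) t = - bump 'X^2 t :> R.
Proof. by rewrite bump_deriv_one bumpN. Qed.

Lemma bump_deriv2 t :
  bump (bump_deriv (bump_deriv 1)) t = - bump (bump_deriv 'X^2) t :> R.
Proof.
rewrite bump_deriv_one -bumpN; congr bump.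
by rewrite /bump_deriv derivN -[RHS]mulNr opprB opprK addrC.
Qed.

Lemma bump_ge0 t : 0 <= bump 'X^2 t :> R.
Proof.
rewrite /bump; case: ifP => // _.
by rewrite hornerXn mulr_ge0 ?expR_ge0// exprn_even_ge0.
Qed.

Lemma bump1_ge0 t : 0 <= bump 1 t :> R.
Proof.
by rewrite /bump; case: ifP => // _; rewrite hornerE mul1r expR_ge0.
Qed.

Lemma mean_kernel_ge0 x r y : 0 < r -> 0 <= mean_kernel x r y.
Proof.
by move=> r0; rewrite mulr_ge0 ?bump_ge0// invr_ge0 exprn_ge0// ltW.
Qed.

Lemma continuous_mean_kernel x r : continuous (mean_kernel x r).
Proof.
by apply: continuous_mul; [exact: continuous_const|exact: continuous_radial_bump].
Qed.

Lemma mean_kernel_supported x r : 0 < r -> supported_in x r (mean_kernel x r).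
Proof. by move=> r0; apply: supported_mul; exact: radial_bump_supported. Qed.

(** With F the standard bump and s = |y - x|^2 / r^2 the kernel is -r^(-N) F'(s), and both sides
    equal r^(-N-1) (N F'(s) + 2 s F''(s)). *)
Lemma is_derive_mean_kernel x y r : 0 < r ->
  is_derive r 1 (fun r => mean_kernel x r y) (r / r ^+ N / 2 * lap_bump x r y).
Proof.
move=> r0; have rn0 : r != 0 by rewrite gt_eqF.
have d1 : is_derive r 1 (fun r : R => r ^- N) (- (N%:R * r ^+ N.-1) / (r ^+ N) ^+ 2).
  apply: is_derive_inv; last by rewrite expf_neq0.
  apply: is_derive_val (is_derive_exprn _ N _ _ _ (is_derive_id _ _)) _.
  by rewrite mulr1.
have d2 : is_derive r 1 (fun r : R => rad x y / r ^+ 2) (rad x y * (- (2 * r) / (r ^+ 2) ^+ 2)).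
  apply: is_derive_scale; apply: is_derive_inv; last by rewrite expf_neq0.
  apply: is_derive_val (is_derive_exprn _ 2 _ _ _ (is_derive_id _ _)) _.
  by rewrite mulr1 expr1.
have d3 := is_derive_mul _ _ _ _ _ _ d1
  (is_derive_compose _ _ _ _ _ _ d2 (is_derive_bump _ 'X^2 _)).
apply: is_derive_val d3 _; rewrite /lap_bump bump_deriv1 bump_deriv2.
set b1 := bump (bump_deriv _) _; set b2 := bump _ _.
move: b1 b2 (rad x y) => b1 b2 s; clear d1 d2 x y.
case: N => [|n]; last first.
  rewrite succnK (exprS r n); move: (r ^+ n) (expf_neq0 n rn0) n.+1%:R => A A0 c; field.
  by rewrite rn0 A0.
by rewrite !expr0; field.
Qed.

Lemma lap_bump_bounded : exists2 C : R, 0 <= C &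
  forall x y r, 0 < r -> `|lap_bump x r y| <= C / r ^+ 2.
Proof.
have [C1 C10 H1] := bump_bounded _ (bump_deriv 1 : {poly R}).
have [C2 C20 H2] := bump_bounded _ (bump_deriv (bump_deriv 1) : {poly R}).
exists (2 * (N%:R * C1 + 2 * C2)).
  by rewrite mulr_ge0// addr_ge0// mulr_ge0.
move=> x y r r0; rewrite /lap_bump normrM ger0_norm; last first.
  by rewrite divr_ge0// exprn_ge0// ltW.
rewrite [leRHS]mulrAC ler_wpM2l ?divr_ge0 ?exprn_ge0 ?(ltW r0)//.
rewrite (le_trans (ler_normD _ _))// lerD//.
  by rewrite normrM normr_nat ler_wpM2l.
set s := rad x y / _.
(* The factor [s] is unbounded, but the bump vanishes beyond 1. *)
have [s1|s1] := leP 1 s.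
  by rewrite bump_ge1// mulr0 normr0 mulr_ge0.
have s0 : 0 <= s by rewrite divr_ge0 ?rad_ge0// exprn_ge0// ltW.
rewrite -mulrA normrM normr_nat ler_wpM2l// normrM (ger0_norm s0).
by rewrite (le_trans _ (H2 s))// ler_piMl// ltW.
Qed.

Lemma is_derive_mean v f x r : weak_laplacian v f -> 0 < r ->
  is_derive r 1 (mean v x)
    (r / r ^+ N / 2 * \int[mu]_y (f y * radial_bump 1 x r y)).
Proof.
move=> [cv cf vf] r0.
have [C C0 HC] := lap_bump_bounded.
have [K K0 HK] := continuous_bounded_cube _ _ v x (2 * r) cv.
(* [D] bounds the r-derivative of the kernel uniformly for radii in (r/2, 2r); with the bound [K] on
   [v] it gives the dominating function for differentiating under the integral. *)
pose D := 2 * r / (r / 2) ^+ N / 2 * (C / (r / 2) ^+ 2).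
have D0 : 0 <= D by rewrite /D !mulr_ge0 ?invr_ge0 ?exprn_ge0 ?divr_ge0// ltW.
pose F (s : R) y := v y * mean_kernel x s y.
have Ir : `](r / 2), (2 * r)[%classic r.
  by rewrite /= in_itv/=; apply/andP; split; move: r0; lra.
have I0 (s : R) : `](r / 2), (2 * r)[%classic s -> 0 < s.
  by rewrite /= in_itv/= => /andP[+ _]; apply: lt_trans; rewrite divr_gt0.
have dF (s : R) y : 0 < s ->
    is_derive s 1 (F ^~ y) (v y * (s / s ^+ N / 2 * lap_bump x s y)).
  by move=> s0; apply: is_derive_scale; exact: is_derive_mean_kernel.
have intF (s : R) : `](r / 2), (2 * r)[%classic s -> mu.-integrable setT (EFin \o F s).
  move=> /I0 s0; apply: (supported_integrable_mul _ _ x s) => //.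
    exact: continuous_mean_kernel.
  exact: mean_kernel_supported.
have derF (s : R) y : `](r / 2), (2 * r)[%classic s -> setT y -> derivable (F ^~ y) s 1.
  by move=> /I0 s0 _; case: (dF s y s0).
pose G y := K * D * \1_(cube x (2 * r)) y.
have G0 y : 0 <= G y by rewrite mulr_ge0// mulr_ge0.
have intG : mu.-integrable setT (EFin \o G).
  apply: (integrable_finite_support _ _ _ mu (cube x (2 * r)) G (K * D)).
  - exact: measurable_cube.
  - exact: cube_fin.
  - apply: measurable_funM; first exact: measurable_cst.
    by apply: measurable_indic; exact: measurable_cube.
  - move=> y; rewrite ger0_norm// /G ler_piMr ?(mulr_ge0 K0 D0)//.
  - move=> y ny; rewrite /G indicE memNset// mulr0//.
have Gub (s : R) y : `](r / 2), (2 * r)[%classic s -> setT y -> `|partial1of2 F s y| <= G y.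
  move=> Is _; have s0 := I0 s Is.
  rewrite partial1of2E; have [_ ->] := dF s y s0.
  have [cy|ny] := pselect (cube x (2 * r) y); last first.
    rewrite lap_bump_supported ?mulr0 ?normr0//.
    move=> H; apply: ny => i; apply: le_trans (H i) _.
    by move: Is; rewrite /= in_itv/= => /andP[_ /ltW].
  rewrite /G indicE mem_set// mulr1 normrM ler_pM// ?HK//.
  rewrite normrM ler_pM//; last first.
    rewrite (le_trans (HC _ _ _ s0))// ler_wpM2l// lef_pV2 ?posrE ?exprn_gt0 ?divr_gt0//.
    rewrite lerXn2r ?nnegrE ?divr_ge0 ?ltW//.
    by move: Is; rewrite /= in_itv/= => /andP[].
  move: Is; rewrite /= in_itv/= => /andP[h1 h2].
  have r2 : 0 < r / 2 by rewrite divr_gt0.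
  rewrite ger0_norm; last by rewrite !divr_ge0// ?exprn_ge0// ltW.
  rewrite ler_wpM2r ?invr_ge0//; apply: ler_pM; rewrite ?invr_ge0 ?exprn_ge0 ?(ltW s0) ?(ltW h2)//.
  by rewrite lef_pV2 ?posrE ?exprn_gt0// lerXn2r ?nnegrE ?ltW.
have dm := derivable_under_integral measurableT Ir intF derF G0 intG Gub.
have em := differentiation_under_integral measurableT Ir intF derF G0 intG Gub.
apply: DeriveDef; first exact: dm.
rewrite -derive1E [LHS]em -vf//.
transitivity (\int[mu]_y (r / r ^+ N / 2 * (v y * lap_bump x r y))).
  apply: eq_Rintegral => y _; rewrite partial1of2E; have [_ ->] := dF r y r0.
  by ring.
rewrite RintegralZl//; apply: (supported_integrable_mul _ _ x r) => //.
  exact: continuous_lap_bump.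
exact: lap_bump_supported.
Qed.

Lemma mean_nondecreasing v f x r s : weak_laplacian v f -> 0 < r -> r <= s ->
  (forall y, rad x y <= s ^+ 2 -> 0 <= f y) -> mean v x r <= mean v x s.
Proof.
move=> vf r0; rewrite le_eqVlt => /predU1P[->//|rs] f0.
have dm t : t \in `]r, s[ -> is_derive t 1 (mean v x)
    (t / t ^+ N / 2 * \int[mu]_y (f y * radial_bump 1 x t y)).
  by rewrite in_itv/= => /andP[rt _]; apply: is_derive_mean => //; exact: lt_trans rt.
have cm : {within `[r, s], continuous (mean v x)}.
  apply: derivable_within_continuous => t; rewrite in_itv/= => /andP[rt _].
  by case: (is_derive_mean v f x t vf (lt_le_trans r0 rt)).
have [t trs E] := MVT rs dm cm.
rewrite -subr_ge0 E; apply: mulr_ge0; last by rewrite subr_ge0 ltW.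
have /andP[rt ts] : r < t < s by move: trs; rewrite in_itv.
have t0 := lt_trans r0 rt.
apply: mulr_ge0; first by rewrite !divr_ge0// ?exprn_ge0// ltW.
apply: Rintegral_ge0 => y _.
have [H|H] := leP (rad x y) (s ^+ 2).
  by apply: mulr_ge0; [exact: f0|exact: bump1_ge0].
rewrite radial_bump0// ?mulr0//; apply/ltW/(le_lt_trans _ H).
by rewrite lerXn2r ?nnegrE ?ltW// (lt_trans t0).
Qed.

Lemma weak_laplacian_const (c : R) : weak_laplacian (fun=> c : R) (fun _ : rV => 0).
Proof.
have := weak_laplacian_rad (c%:P) (0 : rV).
congr weak_laplacian; apply/funext => y; first by rewrite hornerC.
by rewrite derivC linear0 horner0 !mulr0 addr0.
Qed.

(** Both 1 and -1 are weakly harmonic, so monotonicity of means holds in both directions; no change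
    of variables is involved. *)
Lemma mean1_indep x r s : 0 < r -> 0 < s -> mean (fun=> 1) x r = mean (fun=> 1) x s.
Proof.
wlog rs : r s / r <= s.
  by move=> H r0 s0; case/orP: (le_total r s) => h; [|symmetry]; exact: H.
move=> r0 _; apply/eqP; rewrite eq_le; apply/andP; split.
  by apply: (mean_nondecreasing _ _ _ _ _ (weak_laplacian_const 1)).
have := mean_nondecreasing _ _ x _ _ (weak_laplacian_const (- 1)) r0 rs (fun _ _ => lexx 0).
rewrite /mean.
have E t : 0 < t -> \int[mu]_y (-1 * mean_kernel x t y) = - \int[mu]_y (1 * mean_kernel x t y).
  move=> t0; under [in RHS]eq_Rintegral do rewrite mul1r.
  rewrite RintegralZl// ?mulN1r//.
  apply: (supported_integrable _ _ _ x t); first exact: continuous_mean_kernel.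
  exact: mean_kernel_supported.
by rewrite !E ?lerN2// (lt_le_trans r0).
Qed.

End means.

Lemma int_ge_cube (R : realType) N (g : 'rV[R]_N -> R) x r x' e (c : R) :
  continuous g -> supported_in x r g -> (forall y, 0 <= g y) -> 0 <= e ->
  (forall y, cube x' e y -> c <= g y) ->
  c * (e *+ 2) ^+ N <= \int[lebesgue_rV R N]_y g y.
Proof.
move=> cg sg g0 e0 cg'.
have -> : c * (e *+ 2) ^+ N = \int[lebesgue_rV R N]_(y in cube x' e) c.
  rewrite Rintegral_cst; last exact: measurable_cube.
  transitivity (c * fine ((e *+ 2) ^+ N)%:E) => //.
  by rewrite -(lebesgue_rV_cube R N x' e e0).
rewrite Rintegral_mkcond; apply: le_Rintegral => //.
- apply: (integrable_finite_support _ _ _ _ (cube x' e) _ `|c|).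
  + exact: measurable_cube.
  + exact: cube_fin.
  + apply/(measurable_restrictT _ _).1; first exact: measurable_cube.
    exact: measurable_cst.
  + by move=> y; rewrite patchE; case: ifP => // _; rewrite normr0.
  + by move=> y ny; rewrite patchE memNset.
- exact: supported_integrable cg sg.
- by move=> y _; rewrite patchE; case: ifPn => // /set_mem; exact: cg'.
Qed.

Section mean_value.
Context {R : realType} {N : nat}.
Notation rV := 'rV[R]_N.
Notation mu := (lebesgue_rV R N).
Implicit Types (x y : rV) (r : R).

Notation mean1 x r := (mean (fun=> 1) x r).

Lemma mean_lin (a b : R) (v w : rV -> R) x r : 0 < r -> continuous v -> continuous w ->
  mean (fun y => a * v y + b * w y) x r = a * mean v x r + b * mean w x r.
Proof.
move=> r0 cv cw; rewrite /mean; under eq_Rintegral do rewrite mulrDl -!mulrA.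
have ck := continuous_mean_kernel x r; have sk := mean_kernel_supported x r r0.
have i1 := supported_integrable_mul v _ x r cv ck sk.
have i2 := supported_integrable_mul w _ x r cw ck sk.
rewrite RintegralD ?RintegralZl//.
+ exact: (integrableZl measurableT a i1).
+ exact: (integrableZl measurableT b i2).
Qed.

Lemma mean_const (c : R) x r : 0 < r -> mean (fun=> c) x r = c * mean1 x r.
Proof.
move=> r0; rewrite /mean -RintegralZl//.
  by apply: eq_Rintegral => y _; rewrite mul1r.
apply: (supported_integrable_mul _ _ x r) => //; first exact: continuous_const.
  exact: continuous_mean_kernel.
exact: mean_kernel_supported.
Qed.

Lemma ler_mean (v w : rV -> R) x r : 0 < r -> continuous v -> continuous w ->
  (forall y, rad x y <= r ^+ 2 -> v y <= w y) -> mean v x r <= mean w x r.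
Proof.
move=> r0 cv cw vw; apply: le_Rintegral => //.
- apply: (supported_integrable_mul _ _ x r) => //; first exact: continuous_mean_kernel.
  exact: mean_kernel_supported.
- apply: (supported_integrable_mul _ _ x r) => //; first exact: continuous_mean_kernel.
  exact: mean_kernel_supported.
move=> y _; have [h|h] := leP (rad x y) (r ^+ 2).
  by rewrite ler_wpM2r ?mean_kernel_ge0// vw.
by rewrite /mean_kernel (radial_bump0 _ _ _ _ r0 (ltW h)) !mulr0.
Qed.

(** By [mean1_indep] only the radius 1 has to be treated. *)
Lemma mean1_lb : (0 < N)%N -> exists2 K : R, 0 < K &
  forall x r, 0 < r -> K <= mean1 x r.
Proof.
move=> N0; have n0 : 0 < N%:R :> R by rewrite ltr0n.
(* On the cube of radius 1/(2N) the squared distance s is at most N e^2 <= 1/2. Hence z = 1 / (1 -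
   s) lies in [1, 2] and the kernel z^2 e^(-z) is at least e^(-2). *)
pose e := (N%:R * 2)^-1 : R.
have e0 : 0 < e by rewrite invr_gt0 mulr_gt0.
exists (expR (- 2) * (e *+ 2) ^+ N).
  by rewrite mulr_gt0 ?expR_gt0// exprn_gt0// pmulrn_lgt0.
move=> x r r0; rewrite (mean1_indep x r 1)// /mean.
apply: (int_ge_cube _ _ _ x 1 x).
- by apply: continuous_mul; [exact: continuous_const|exact: continuous_mean_kernel].
- by apply: supported_mul; exact: mean_kernel_supported.
- by move=> y; rewrite mul1r mean_kernel_ge0.
- exact: ltW.
move=> y /cube_rad H; rewrite mul1r /mean_kernel expr1n invr1 mul1r /radial_bump.
have {}H : rad x y <= 2^-1.
  apply: (le_trans H); rewrite /e invfM exprMn exprVn.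
  have n1 : 1 <= N%:R :> R by rewrite ler1n.
  have -> : N%:R * (N%:R ^- 2 * 2^-1 ^+ 2) = 4^-1 * N%:R^-1 :> R by field; rewrite gt_eqF.
  have : N%:R^-1 <= 1 :> R by rewrite invf_le1.
  by move: (N%:R^-1) => z; lra.
rewrite expr1n divr1; set s := rad x y in H *.
have s0 : 0 <= s by exact: rad_ge0.
have s1 : s < 1 by lra.
rewrite /bump s1 hornerXn -[leLHS]mul1r.
have h1 : 1 <= (1 - s)^-1 by rewrite invf_ge1 ?subr_gt0//; lra.
apply: ler_pM => //; rewrite ?expR_ge0 ?exprn_ege1//.
rewrite ler_expR lerN2 -[leRHS]invrK lef_pV2 ?posrE ?subr_gt0//; lra.
Qed.

(** Continuity gives the inequality up to [d] at a small radius, and monotonicity of the means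
    carries it to [r]. The means are not normalised, hence the factor [mean1]. *)
Lemma mean_value0 v f x r : weak_laplacian v f -> (0 < N)%N -> 0 < r ->
  (forall y, rad x y <= r ^+ 2 -> 0 <= f y) -> mean1 x r * v x <= mean v x r.
Proof.
move=> vf N0 r0 f0; have [cv cf _] := vf.
have [K K0 HK] := mean1_lb N0.
have k0 := lt_le_trans K0 (HK x r r0).
apply/ler_addgt0Pr => d d0.
pose e := d / mean1 x r.
have e0 : 0 < e by rewrite divr_gt0.
have [q q0 Hq] : exists2 q : R, 0 < q & forall y, cube x q y -> v x - e <= v y.
  have /cvgrPdist_le/(_ e e0)/nbhs_cube[q q0 Hq] := cv x.
  by exists q => // y /Hq /=; rewrite ler_distlC => /andP[].
pose s := Num.min q r.
have s0 : 0 < s by rewrite lt_min q0 r0.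
have sr : s <= r by rewrite ge_min lexx orbT.
apply: (@le_trans _ _ (mean v x s + d)); last first.
  by rewrite lerD2r; apply: mean_nondecreasing vf s0 sr f0.
rewrite -lerBlDr (_ : d = e * mean1 x r); last by rewrite /e divfK// gt_eqF.
rewrite mulrC -mulrBl (mean1_indep x r s r0 s0) -(mean_const _ _ _ s0).
apply: ler_mean => // [|y]; first exact: continuous_const.
move=> /(rad_le_cube _ _ _ (ltW s0)) H; apply: Hq => i.
by rewrite (le_trans (H i))// ge_min lexx.
Qed.

Lemma weak_laplacian_dist x : weak_laplacian (rad x) (fun=> 2 * N%:R).
Proof.
have := weak_laplacian_rad 'X x; congr weak_laplacian; apply/funext => y.
  by rewrite hornerX.
by rewrite derivX -polyC1 derivC horner0 hornerC mulr0 add0r mulr1.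
Qed.

(** Subtracting F/(2N) |y - x|^2, whose Laplacian is [F], reduces to a nonnegative right-hand side
    without changing the value at [x]. The sign of [F] is free. *)
Lemma mean_value v f x r (F : R) : weak_laplacian v f -> (0 < N)%N -> 0 < r ->
  (forall y, rad x y <= r ^+ 2 -> F <= f y) ->
  mean1 x r * v x <= mean v x r - F / (2 * N%:R) * mean (rad x) x r.
Proof.
move=> vf N0 r0 fF; have [cv _ _] := vf.
have n0 : 0 < 2 * N%:R :> R by rewrite mulr_gt0// ltr0n.
have := weak_laplacian_lin 1 (- (F / (2 * N%:R))) _ _ _ _ vf (weak_laplacian_dist x).
move=> /mean_value0 -/(_ x r N0 r0).
rewrite radxx mulr0 addr0 mul1r mean_lin// ?mul1r ?mulNr; last exact: continuous_rad.
apply=> y yr; rewrite mul1r divfK ?gt_eqF// subr_ge0.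
exact: fF.
Qed.

Lemma mean_rad_le x r : 0 < r -> mean (rad x) x r <= r ^+ 2 * mean1 x r.
Proof.
move=> r0; rewrite -mean_const//; apply: ler_mean => //.
  exact: continuous_rad.
exact: continuous_const.
Qed.

Lemma mean_rad_gt0 x r : (0 < N)%N -> 0 < r -> 0 < mean (rad x) x r.
Proof.
move=> N0 r0; pose i0 := Ordinal N0.
(* [rad x] vanishes at the centre, so positivity is read off at a point at distance r/2, where both
   factors are positive. *)
pose x' : rV := \row_i (x ord0 i + (r / 2) * (i == i0)%:R).
have rx' : rad x x' = (r / 2) ^+ 2.
  rewrite /rad (bigD1 i0)//= mxE eqxx mulr1 addrAC subrr add0r big1 ?addr0// => i /negbTE ii.
  by rewrite mxE ii mulr0 addr0 subrr expr0n.
pose g y := rad x y * mean_kernel x r y.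
have cg : continuous g.
  by apply: continuous_mul; [exact: continuous_rad|exact: continuous_mean_kernel].
have gx' : 0 < g x'.
  rewrite /g rx' /mean_kernel /radial_bump rx'.
  have -> : (r / 2) ^+ 2 / r ^+ 2 = 4^-1 by field; rewrite gt_eqF.
  rewrite mulr_gt0 ?exprn_gt0 ?divr_gt0// mulr_gt0 ?invr_gt0 ?exprn_gt0//.
  rewrite /bump ifT; last by lra.
  by rewrite hornerXn mulr_gt0 ?expR_gt0// exprn_gt0// invr_gt0; lra.
have /cvgrPdist_le/(_ (g x' / 2)) := cg x'.
rewrite divr_gt0// => /(_ isT)/nbhs_cube[e e0 He].
apply: (@lt_le_trans _ _ (g x' / 2 * (e *+ 2) ^+ N)).
  by rewrite mulr_gt0 ?divr_gt0// exprn_gt0// pmulrn_lgt0.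
apply: (int_ge_cube _ _ _ x r x') => //.
- by apply: supported_mul; exact: mean_kernel_supported.
- by move=> y; rewrite mulr_ge0 ?rad_ge0 ?mean_kernel_ge0.
- exact: ltW.
by move=> y /He /=; rewrite ler_distlC => /andP[+ _]; apply: le_trans; rewrite -/(g x'); lra.
Qed.

(** If [f x > 0], then [f] exceeds [f x / 2] on a small ball where [v <= v x]. The strictly positive
    gain in [mean_value] then contradicts [mean v x q <= mean1 x q * v x]. *)
Lemma weak_laplacian_local_max v f x : weak_laplacian v f -> (0 < N)%N ->
  (\forall y \near x, v y <= v x) -> f x <= 0.
Proof.
move=> vf N0 vmax; have [cv cf _] := vf.
rewrite leNgt; apply/negP => fx.
have /cvgrPdist_le/(_ (f x / 2)) := cf x.
rewrite divr_gt0// => /(_ isT) fnear.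
have [q q0 Hq] := nbhs_cube _ _ _ _ (filterI vmax fnear).
have H y : rad x y <= q ^+ 2 -> v y <= v x /\ f x / 2 <= f y.
  move=> /(rad_le_cube _ _ _ (ltW q0))/Hq[] /= vy; rewrite ler_distlC => /andP[+ _].
  by move=> h; split => //; apply: le_trans h; lra.
have := mean_value v f x q _ vf N0 q0 (fun y h => (H y h).2).
have : mean v x q <= mean1 x q * v x.
  rewrite mulrC -mean_const//; apply: ler_mean => //; first exact: continuous_const.
  by move=> y /H[].
have : 0 < f x / 2 / (2 * N%:R) * mean (rad x) x q.
  by rewrite mulr_gt0 ?mean_rad_gt0// divr_gt0 ?divr_gt0// mulr_gt0// ltr0n.
lra.
Qed.

Lemma weak_laplacian_touch v f (T : {poly R}) x : weak_laplacian v f -> (0 < N)%N ->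
  v x = T.[rad 0 x] -> (\forall y \near x, v y <= T.[rad 0 y]) ->
  f x <= 4 * rad 0 x * T^`()^`().[rad 0 x] + 2 * N%:R * T^`().[rad 0 x].
Proof.
move=> vf N0 vx vT.
have /weak_laplacian_local_max := weak_laplacian_lin 1 (- 1) _ _ _ _ vf (weak_laplacian_rad T 0).
move=> /(_ x N0); rewrite !mul1r !mulN1r subr_le0; apply.
by near=> y; rewrite vx subrr mul1r mulN1r subr_le0; near: y.
Unshelve. all: by end_near. Qed.

End mean_value.

(** * Touching weak solutions from above by radial functions *)

(** A second derivative test in which [h1] is differentiable at [r] only: near [r], [h1 s] has the
    sign of [s - r], and the mean value theorem on each side gives the sign of [h]. *)
Lemma touch_convex (R : realType) (h h1 : R -> R) (r d : R) :
  (\forall s \near r, is_derive (s : R) 1 h (h1 s)) -> h r = 0 -> h1 r = 0 ->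
  is_derive r 1 h1 d -> 0 < d -> \forall s \near r, 0 <= h s.
Proof.
move=> dh hr h1r [dh1 dE] d0.
have : (fun t : R => t^-1 *: ((h1 \o shift r) (t *: 1) - h1 r)) @ 0^' --> d.
  by rewrite -dE; exact: dh1.
move=> /(cvgr_gt d) -/(_ 0 d0) H.
have [e /= e0 He] : exists2 e : R, 0 < e & forall s, `|s - r| < e ->
    is_derive (s : R) 1 h (h1 s) /\ (s != r -> 0 < (s - r) * h1 s).
  move: H => /nbhs_ballP[e1 /= e10 He1].
  move: dh => /nbhs_ballP[e2 /= e20 He2].
  exists (Num.min e1 e2); first by rewrite lt_min e10.
  move=> s; rewrite lt_min => /andP[s1 s2]; split.
    by apply: He2; rewrite /ball/= distrC.
  move=> sr; have s0 : s - r != 0 by rewrite subr_eq0.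
  have := He1 (s - r); rewrite /ball/= sub0r normrN => /(_ s1 s0).
  rewrite /= [(s - r)%:A]mulr1 subrK h1r subr0 => hs.
  have -> : (s - r) * h1 s = (s - r) ^+ 2 * ((s - r)^-1 *: h1 s).
    by rewrite /GRing.scale/=; field.
  by rewrite mulr_gt0// exprn_even_gt0.
apply/nbhs_ballP; exists e => //= s; rewrite /ball/= distrC => sr.
have [rs|rs|rs] := ltgtP r s; last by rewrite -rs hr.
- have mv : forall t, t \in `[r, s] -> `|t - r| < e.
    move=> t; rewrite in_itv/= => /andP[t1 t2]; apply: le_lt_trans sr.
    by rewrite !ger0_norm ?subr_ge0// ?lerB// ltW.
  have [t tI E] : exists2 t, t \in `]r, s[%R & h s - h r = h1 t * (s - r).
    apply: MVT => // [t tI|].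
      by have [] := He t (mv t (subset_itv_oo_cc tI)).
    apply: derivable_within_continuous => t tI.
    by have [[]] := He t (mv t tI).
  rewrite hr subr0 in E; rewrite E.
  have := mv t (subset_itv_oo_cc tI); move: tI; rewrite in_itv/= => /andP[rt ts] /He[_].
  rewrite gt_eqF// => /(_ isT); rewrite pmulr_rgt0 ?subr_gt0// => ht.
  by rewrite mulr_ge0 ?ltW// subr_gt0.
- have mv : forall t, t \in `[s, r] -> `|t - r| < e.
    move=> t; rewrite in_itv/= => /andP[t1 t2]; apply: le_lt_trans sr.
    by rewrite !ler0_norm ?subr_le0// ?lerN2 ?lerB// ltW.
  have [t tI E] : exists2 t, t \in `]s, r[%R & h r - h s = h1 t * (r - s).
    apply: MVT => // [t tI|].
      by have [] := He t (mv t (subset_itv_oo_cc tI)).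
    apply: derivable_within_continuous => t tI.
    by have [[]] := He t (mv t tI).
  rewrite hr sub0r in E.
  have := mv t (subset_itv_oo_cc tI); move: tI; rewrite in_itv/= => /andP[rt ts] /He[_].
  rewrite lt_eqF// => /(_ isT); rewrite nmulr_rgt0 ?subr_lt0// => ht.
  by rewrite -[h s]opprK E oppr_ge0 nmulr_rle0// subr_ge0 ltW.
Qed.

Section radial_touch.
Context {R : realType} {N : nat}.
Notation rV := 'rV[R]_N.
Implicit Types (x y : rV).

Lemma continuous_eucl_norm : continuous (@eucl_norm R N).
Proof.
rewrite (_ : @eucl_norm R N = Num.sqrt \o rad 0).
  by move=> y; apply: continuous_comp; [exact: continuous_rad|exact: sqrt_continuous].
by apply/funext => z; exact: eucl_normE.
Qed.

Lemma sqr_eucl_norm y : eucl_norm y ^+ 2 = rad 0 y.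
Proof. by rewrite eucl_normE sqr_sqrtr// rad_ge0. Qed.

(** The profile is replaced by a polynomial in |y|^2 that touches it from above: it has the same
    value and slope at [r] and a second derivative larger by [d]. The slack [d] makes the difference
    locally nonnegative and is then sent to 0. *)
Lemma weak_laplacian_radial_touch (v f : rV -> R) (g g1 : R -> R) (g2 : R) x :
  weak_laplacian v f -> (0 < N)%N -> 0 < eucl_norm x ->
  (\forall s \near eucl_norm x, is_derive (s : R) 1 g (g1 s)) ->
  is_derive (eucl_norm x) 1 g1 g2 ->
  v x = g (eucl_norm x) -> (\forall y \near x, v y <= g (eucl_norm y)) ->
  f x <= g2 + (N%:R - 1) / eucl_norm x * g1 (eucl_norm x).
Proof.
move=> vf N0; set r := eucl_norm x => r0 dg dg1 vx vg.
have rn0 : r != 0 by rewrite gt_eqF.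
apply/ler_addgt0Pr => d d0.
(* [t1] and [t2] are T' and T'' at r^2, solved from the derivatives of s |-> T(s^2): 2 r t1 = g1 r
   and 2 t1 + 4 r^2 t2 = g2 + d. *)
pose t1 := g1 r / (2 * r).
pose t2 := (g2 - 2 * t1 + d) / (4 * r ^+ 2).
pose Q : {poly R} := 'X - (r ^+ 2)%:P.
pose T : {poly R} := (g r)%:P + t1 *: Q + (t2 / 2) *: Q ^+ 2.
have T1 : T^`() = t1%:P + t2 *: Q.
  rewrite /T !derivD derivC add0r !derivZ deriv_exp derivB derivX derivC subr0 mul1r.
  by rewrite expr1 -scalerMnr scalerMnl -mulr_natr divfK// alg_polyC.
have T2 : T^`()^`() = t2%:P.
  by rewrite T1 derivD derivC add0r derivZ derivB derivX derivC subr0 alg_polyC.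
have xr : rad 0 x = r ^+ 2 by rewrite sqr_eucl_norm.
have Qr : Q.[r ^+ 2] = 0 by rewrite !hornerE subrr.
have Tr : T.[r ^+ 2] = g r.
  by rewrite /T hornerD hornerD hornerC !hornerZ horner_exp Qr expr0n !mulr0 !addr0.
have T1r : T^`().[r ^+ 2] = t1.
  by rewrite T1 hornerD hornerC hornerZ Qr mulr0 addr0.
have := weak_laplacian_touch v f T x vf N0.
rewrite T2 xr T1r hornerC.
have -> : 4 * r ^+ 2 * t2 + 2 * N%:R * t1 = g2 + (N%:R - 1) / r * g1 r + d.
  by rewrite /t2 /t1; field.
apply.
  by rewrite vx Tr.
have nT : \forall s \near r, 0 <= T.[s ^+ 2] - g s.
  apply: (@touch_convex _ (fun s => T.[s ^+ 2] - g s)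
      (fun s => T^`().[s ^+ 2] * (2 * s) - g1 s) r d) => //.
  - near=> s; apply: is_derive_sub; last by near: s.
    apply: is_derive_compose (is_derive_poly T _).
    apply: is_derive_val (is_derive_exprn _ 2 _ _ _ (is_derive_id _ _)) _.
    by rewrite mulr1 expr1.
  - by rewrite Tr subrr.
  - by rewrite T1r /t1; field.
  - have d2 : is_derive r 1 (fun s : R => s ^+ 2) (2 * r).
      apply: is_derive_val (is_derive_exprn _ 2 _ _ _ (is_derive_id _ _)) _.
      by rewrite mulr1 expr1.
    have d3 := is_derive_mul _ _ _ _ _ _ (is_derive_compose _ _ _ _ _ _ d2 (is_derive_poly T^`() _))
      (is_derive_scale 2 _ _ _ _ (is_derive_id r 1)).
    apply: is_derive_val (is_derive_sub _ _ _ _ _ _ d3 dg1) _.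
    rewrite T2 T1r hornerC /t2.
    by field.
have nT' : \forall y \near x, 0 <= T.[eucl_norm y ^+ 2] - g (eucl_norm y).
  exact: (continuous_eucl_norm x _ nT).
near=> y; apply: le_trans (_ : g (eucl_norm y) <= _); first by near: y.
by rewrite -sqr_eucl_norm -subr_ge0; near: y.
Unshelve. all: by end_near. Qed.

End radial_touch.

(** * Local bounds for Schroedinger equations *)

Section local_bound.
Context {R : realType} {N : nat}.
Notation rV := 'rV[R]_N.
Notation mu := (lebesgue_rV R N).
Implicit Types (x y : rV) (r : R) (A B u : rV -> R).

(* Real form of [Lap u = (A + iB) u] for [u = u1 + i u2]. *)
Definition complex_schroedinger A B u1 u2 : Prop :=
  weak_laplacian u1 (fun y => A y * u1 y - B y * u2 y) /\
  weak_laplacian u2 (fun y => A y * u2 y + B y * u1 y).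

Definition modulus u1 u2 y : R := Num.sqrt (u1 y ^+ 2 + u2 y ^+ 2).

Lemma modulus_ge0 u1 u2 y : 0 <= modulus u1 u2 y.
Proof. exact: sqrtr_ge0. Qed.

Lemma sqr_modulus u1 u2 y : modulus u1 u2 y ^+ 2 = u1 y ^+ 2 + u2 y ^+ 2.
Proof. by rewrite sqr_sqrtr// addr_ge0 ?sqr_ge0. Qed.

Lemma continuous_modulus u1 u2 : continuous u1 -> continuous u2 ->
  continuous (modulus u1 u2).
Proof.
move=> c1 c2 y; apply: (@continuous_comp _ _ _ (fun y => u1 y ^+ 2 + u2 y ^+ 2) Num.sqrt).
  by apply: continuous_add; under eq_fun do rewrite expr2; exact: continuous_mul.
exact: sqrt_continuous.
Qed.

Lemma rotation_le_modulus u1 u2 (c1 c2 : R) y : c1 ^+ 2 + c2 ^+ 2 = 1 ->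
  `|c1 * u1 y + c2 * u2 y| <= modulus u1 u2 y.
Proof.
move=> c; rewrite -ler_sqr ?nnegrE ?modulus_ge0// real_normK ?num_real//.
rewrite sqr_modulus -[leRHS]mul1r -c.
(* Lagrange's identity: the gap in Cauchy-Schwarz is this square. *)
have := sqr_ge0 (c1 * u2 y - c2 * u1 y); move: (u1 y) (u2 y) => a b; nra.
Qed.

(* Rotating the phase so that [u] is real positive at [x] replaces Kato's
   inequality in all the maximum-principle arguments. *)
Lemma phase_rotation A B u1 u2 x : complex_schroedinger A B u1 u2 ->
  0 < modulus u1 u2 x ->
  exists v f, [/\ weak_laplacian v f, v x = modulus u1 u2 x,
    f x = A x * modulus u1 u2 x,
    forall y, v y <= modulus u1 u2 y &
    forall y, - ((`|A y| + `|B y|) * modulus u1 u2 y) <= f y].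
Proof.
move=> [s1 s2] m0; set m := modulus u1 u2 x in m0 *.
pose c1 := u1 x / m; pose c2 := u2 x / m.
have mn0 : m != 0 by rewrite gt_eqF.
have c : c1 ^+ 2 + c2 ^+ 2 = 1.
  by rewrite !exprMn -mulrDl -sqr_modulus -/m -exprMn divff// expr1n.
exists (fun y => c1 * u1 y + c2 * u2 y), (fun y => c1 * (A y * u1 y - B y * u2 y) +
  c2 * (A y * u2 y + B y * u1 y)); split.
- exact: weak_laplacian_lin.
- have := sqr_modulus u1 u2 x; rewrite -/m /c1 /c2 => h.
  by rewrite mulrAC [X in _ + X]mulrAC -mulrDl -!expr2 -h expr2 mulfK.
(* The [B] terms cancel at [x], where the rotated function is real. *)
- have := sqr_modulus u1 u2 x; rewrite -/m /c1 /c2 => h.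
  transitivity (A x * (u1 x ^+ 2 + u2 x ^+ 2) / m); first by field.
  by rewrite -h; field.
- by move=> y; apply: le_trans (ler_norm _) (rotation_le_modulus _ _ _ _ _ c).
move=> y; rewrite lerNl; apply: le_trans (ler_norm _) _; rewrite normrN.
(* [f] is [A] times the real part minus [B] times the imaginary part of the rotated function; each
   part is again a rotation of (u1, u2). *)
have -> : c1 * (A y * u1 y - B y * u2 y) + c2 * (A y * u2 y + B y * u1 y) =
  A y * (c1 * u1 y + c2 * u2 y) + B y * (c2 * u1 y + (- c1) * u2 y) by ring.
rewrite (le_trans (ler_normD _ _))// mulrDl !normrM lerD// ler_wpM2l//.
  exact: rotation_le_modulus.
by apply: rotation_le_modulus; rewrite sqrrN addrC.
Qed.

Lemma cube_normP x e y : 0 <= e -> cube x e y <-> `|y - x| <= e.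
Proof.
move=> e0; split=> H.
  rewrite [leLHS]/Num.norm/= mx_normrE; apply: bigmax_le => // -[i j] _ /=.
  by rewrite (ord1 i) !mxE; exact: H.
move=> i; apply: le_trans H; have -> : y ord0 i - x ord0 i = (y - x) ord0 i by rewrite !mxE.
rewrite [leRHS]/Num.norm/= mx_normrE.
by apply: (le_bigmax _ (fun ij : 'I_1 * 'I_N => `|(y - x) ij.1 ij.2|) (ord0, i)).
Qed.

Lemma cube_indic x e : 0 <= e ->
  mu.-integrable setT (EFin \o (\1_(cube x e) : rV -> R)) /\
  \int[mu]_y \1_(cube x e) y = (e *+ 2) ^+ N.
Proof.
move=> e0; split.
  apply: (integrable_finite_support _ _ _ mu (cube x e) _ 1).
  - exact: measurable_cube.
  - exact: cube_fin.
  - by apply: measurable_indic; exact: measurable_cube.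
  - by move=> y; rewrite indicE normr_nat lern1 leq_b1.
  - by move=> y ny; rewrite indicE memNset.
rewrite /Rintegral integral_indic//; last exact: measurable_cube.
by rewrite setIT [X in fine X](lebesgue_rV_cube R N x e e0).
Qed.

(** At a maximum point [c] of the weighted modulus, [W] is at most 2^N W(c) on a cube of radius
    comparable to the weight d(c), so the potential term in the mean value inequality is controlled
    by W(c) itself. On a radius of order d(c)/Q it is absorbed, and the mean costs d(c)^(-N) Q^N.
    The exponent N of the weight is the one that cancels this singularity. *)
Lemma local_bound : (0 < N)%N -> exists2 C : R, 0 < C &
  forall A B u1 u2, complex_schroedinger A B u1 u2 ->
    mu.-integrable setT (EFin \o (fun y => modulus u1 u2 y ^+ 2)) ->
    \int[mu]_y (modulus u1 u2 y ^+ 2) <= 1 ->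
    forall x Q, 1 <= Q -> (forall y, cube x 1 y -> `|A y| + `|B y| <= Q) ->
      modulus u1 u2 x <= C * Q ^+ N.
Proof.
move=> N0.
have [K K0 HK] := @mean1_lb R N N0.
have [CB CB0 HCB] := bump_bounded R 'X^2.
pose L : R := 2 ^+ N.+1.
have L0 : 0 < L by rewrite exprn_gt0.
pose C0 := 2 / K * (CB + 1) * (2 ^+ N + 1).
have C00 : 0 < C0.
  by rewrite !mulr_gt0 ?invr_gt0// ?ltr_wpDl// exprn_ge0.
exists (C0 * L ^+ N); first by rewrite mulr_gt0// exprn_gt0.
move=> A B u1 u2 su iW IW x Q Q1 AB; pose W := modulus u1 u2.
have W0 y : 0 <= W y by exact: modulus_ge0.
have [cu1 cu2] : continuous u1 /\ continuous u2 by case: su => [[? _ _] [? _ _]].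
have cW : continuous W by exact: continuous_modulus.
have Q0 : 0 < Q by rewrite (lt_le_trans ltr01).
have [->|Wx] := eqVneq (modulus u1 u2 x) 0.
  by rewrite ltW// mulr_gt0 ?exprn_gt0// mulr_gt0 ?exprn_gt0.
have {}Wx : 0 < W x by rewrite lt_neqAle eq_sym Wx W0.
pose d y : R := 1 - `|y - x|.
have cd : continuous d.
  have c1 : continuous (fun y : rV => y - x).
    move=> y U /nbhs_cube[e e0 He].
    apply: filterS (cube_nbhs _ _ y e e0) => z Hz; apply: He => i.
    by rewrite !mxE opprB addrA subrK; exact: Hz.
  have c2 : continuous (fun y : rV => `|y - x|).
    by move=> y; apply: (continuous_comp (c1 y)); exact: norm_continuous.
  exact: (continuous_add _ _ (continuous_const 1) (continuous_opp _ c2)).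
have cx1 : cube x 1 x by move=> i; rewrite subrr normr0.
have [||c /set_mem cc Hc] := @compact_EVT_max _ R (fun y => d y ^+ N * W y) (cube x 1) _
  (cube_compact R N x 1).
- by exists x.
- apply: continuous_subspaceT => y; apply: (continuous_mul (fun y => d y ^+ N)) => //.
  move=> z; apply: (@continuous_comp _ _ _ d (fun t => t ^+ N)); first exact: cd.
  exact: exprn_continuous.
have {}Hc y : cube x 1 y -> d y ^+ N * W y <= d c ^+ N * W c.
  by move=> h; apply: Hc; rewrite inE.
have Wxc : W x <= d c ^+ N * W c.
  by have := Hc x cx1; rewrite /d subrr normr0 subr0 expr1n mul1r.
have dc0 : 0 <= d c by rewrite subr_ge0; exact/cube_normP.
have {dc0}dc : 0 < d c.
  rewrite lt_neqAle eq_sym dc0 andbT; apply/eqP => h.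
  by move: Wxc; rewrite h expr0n gtn_eqF// mul0r leNgt Wx.
have dc1 : d c <= 1 by rewrite /d lerBlDr lerDl.
have Uc : 0 < W c.
  by have := lt_le_trans Wx Wxc; rewrite pmulr_rgt0// exprn_gt0.
(* [th <= 1/2] keeps the cube within half the distance to the boundary, and Q 2^N th^2 = th/2.
   Together with the factor 1/(2N) of [mean_value], the potential term is then at most half of
   [k * W c]. *)
pose th := (L * Q)^-1.
have th0 : 0 < th by rewrite invr_gt0 mulr_gt0.
have L2 : 2 <= L by rewrite /L exprS ler_peMr// exprn_ege1// ler1n.
have thQ : th * L * Q = 1 by rewrite /th; field; rewrite !gt_eqF.
have th2 : th <= 2^-1.
  rewrite /th lef_pV2 ?posrE ?mulr_gt0//.
  by rewrite (le_trans L2)// ler_peMr// ltW.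
pose r := th * d c.
have r0 : 0 < r by rewrite mulr_gt0.
have r1 : r <= d c / 2 by rewrite /r [leRHS]mulrC ler_pM2r.
(* On this cube [d y >= d c / 2], so maximality at [c] costs only the factor 2^N. *)
have WU y : cube c r y -> cube x 1 y /\ W y <= 2 ^+ N * W c.
  move=> /(cube_normP _ _ _ (ltW r0)) yc.
  have yx : `|y - x| <= 1 - d c / 2.
    have := ler_distD c y x; rewrite /d in r1 *; lra.
  have y1 : cube x 1 y.
    by apply/cube_normP => //; apply: le_trans yx _; rewrite gerDl oppr_le0 ltW// divr_gt0.
  split => //; have := Hc y y1.
  have dy : d c / 2 <= d y by rewrite /d in yx *; lra.
  have dn : (d c / 2) ^+ N <= d y ^+ N.
    by rewrite lerXn2r ?nnegrE// ?(le_trans _ dy)// ltW// divr_gt0.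
  move=> h; have : (d c / 2) ^+ N * W y <= d c ^+ N * W c.
    by apply: le_trans h; rewrite ler_wpM2r.
  rewrite expr_div_n mulrAC ler_pdivrMr ?exprn_gt0// -mulrA ler_pM2l ?exprn_gt0//.
  by rewrite mulrC.
have [v [f [vf vc fc vW fW]]] := phase_rotation A B u1 u2 c su Uc.
pose F := - (Q * (2 ^+ N * W c)).
have fF y : rad c y <= r ^+ 2 -> F <= f y.
  move=> /(rad_le_cube _ _ _ (ltW r0))/WU[y1 Wy]; apply: le_trans (fW y).
  by rewrite lerN2; apply: ler_pM; [exact: addr_ge0|exact: W0|exact: AB|].
have := mean_value v f c r F vf N0 r0 fF; rewrite vc -/(W c).
have k0 := lt_le_trans K0 (HK c r r0).
set k := mean _ c r in k0 *.
move=> main.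
have : - (F / (2 * N%:R) * mean (rad c) c r) <= W c / 2 * k.
  have mr := mean_rad_le c r r0; rewrite -/k in mr.
  have Fr : Q * (2 ^+ N * W c) * r ^+ 2 <= W c.
    have -> : Q * (2 ^+ N * W c) * r ^+ 2 = W c * (Q * 2 ^+ N * r ^+ 2) by ring.
    rewrite ler_piMr//; have rt : r ^+ 2 <= th ^+ 2.
      rewrite lerXn2r ?nnegrE ?(ltW r0) ?(ltW th0)//.
      by rewrite /r ler_piMr// ltW.
    apply: (@le_trans _ _ (Q * 2 ^+ N * th ^+ 2)).
      by rewrite ler_wpM2l// mulr_ge0 ?exprn_ge0// ltW.
    have -> : Q * 2 ^+ N * th ^+ 2 = (th * L * Q) * (th / 2).
      by rewrite /L [2 ^+ N.+1]exprS; field.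
    by rewrite thQ mul1r; move: th2; lra.
  rewrite /F !mulNr opprK.
  apply: (@le_trans _ _ (Q * (2 ^+ N * W c) / (2 * N%:R) * (r ^+ 2 * k))).
    by rewrite ler_wpM2l// divr_ge0 ?mulr_ge0 ?exprn_ge0// ltW.
  have -> : Q * (2 ^+ N * W c) / (2 * N%:R) * (r ^+ 2 * k) =
    Q * (2 ^+ N * W c) * r ^+ 2 / 2 / N%:R * k by field; rewrite pnatr_eq0 -lt0n.
  rewrite ler_wpM2r// ?(ltW k0)//.
  apply: (@le_trans _ _ (W c / 2 / N%:R)).
    by rewrite ler_wpM2r ?invr_ge0// ler_wpM2r ?invr_ge0.
  by rewrite ler_pdivrMr ?ltr0n// ler_peMr ?divr_ge0// ler1n.
(* W <= 1 + W^2 turns the L^2 bound into an L^1 bound on the cube; the indicator contributes the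
   volume 2^N. *)
have : mean v c r <= r ^- N * CB * (2 ^+ N + 1).
  pose G y := r ^- N * CB * (\1_(cube c 1) y + W y ^+ 2).
  have i1 : mu.-integrable setT (EFin \o (fun y => \1_(cube c 1) y + W y ^+ 2)).
    exact: (integrableD measurableT (cube_indic c 1 ler01).1 iW).
  have iG : mu.-integrable setT (EFin \o G) by exact: (integrableZl measurableT _ i1).
  have ck := continuous_mean_kernel c r; have sk := mean_kernel_supported c r r0.
  have [cv _ _] := vf.
  have iv := supported_integrable_mul v _ c r cv ck sk.
  apply: (@le_trans _ _ (\int[mu]_y G y)).
    apply: le_Rintegral => // y _; rewrite /G.
    have [cy|ny] := pselect (cube c r y); last first.
      rewrite (sk _ ny) mulr0 mulr_ge0//; first by rewrite mulr_ge0// invr_ge0 exprn_ge0// ltW.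
      by rewrite addr_ge0// sqr_ge0.
    rewrite indicE mem_set; last first.
      by move=> i; rewrite (le_trans (cy i))// (le_trans r1)// ler_pdivrMr//; lra.
    have kb : mean_kernel c r y <= r ^- N * CB.
      rewrite ler_wpM2l ?invr_ge0 ?exprn_ge0 ?(ltW r0)//.
      exact: le_trans (ler_norm _) (HCB _).
    apply: (@le_trans _ _ (W y * mean_kernel c r y)).
      by rewrite ler_wpM2r// mean_kernel_ge0.
    rewrite mulrC; apply: ler_pM => //; first exact: mean_kernel_ge0.
    have := sqr_ge0 (W y - 1); move: (W y) => w; rewrite mulr1n; nra.
  rewrite /G RintegralZl//.
  rewrite ler_wpM2l//; first by rewrite mulr_ge0// invr_ge0 exprn_ge0// ltW.
  by rewrite RintegralD ?(cube_indic c 1 ler01).1 ?(cube_indic c 1 ler01).2// lerD2l.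
move=> h1 h2.
have {main h1 h2} U1 : W c <= C0 * r ^- N.
  have rN : 0 < r ^- N by rewrite invr_gt0 exprn_gt0.
  have e1 : W c * k / 2 <= r ^- N * CB * (2 ^+ N + 1).
    by move: main h1 h2; move: (_ * mean (rad c) c r) (mean v c r) => p q; nra.
  have e2 : W c * K / 2 <= W c * k / 2.
    by rewrite ler_wpM2r// ler_wpM2l// ?(ltW Uc)//; exact: HK.
  have e3 : r ^- N * CB * (2 ^+ N + 1) <= r ^- N * (CB + 1) * (2 ^+ N + 1).
    rewrite ler_wpM2r ?addr_ge0 ?exprn_ge0// ler_wpM2l ?(ltW rN)//.
    by rewrite lerDl.
  have := le_trans e2 (le_trans e1 e3).
  move=> h; rewrite -(@ler_pM2r _ (K / 2)) ?divr_gt0// mulrA.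
  apply: (le_trans h); rewrite le_eqVlt; apply/orP; left; apply/eqP.
  by rewrite /C0; field; rewrite !gt_eqF ?exprn_gt0.
(* Here [d c ^+ N] cancels against r^(-N) = th^(-N) d(c)^(-N). *)
apply: (le_trans Wxc); apply: le_trans (_ : d c ^+ N * (C0 * r ^- N) <= _).
  by rewrite ler_wpM2l// exprn_ge0// ltW.
rewrite /r exprMn invfM.
have -> : d c ^+ N * (C0 * (th ^- N * d c ^- N)) = C0 * th ^- N.
  by field; rewrite !expf_neq0// gt_eqF.
by rewrite /th exprVn invrK exprMn mulrA.
Qed.

End local_bound.

Lemma continuous_powR_abs (R : realType) (p : R) : 0 < p ->
  continuous (fun t : R => `|t| `^ p).
Proof.
move=> p0 t; have [->|t0] := eqVneq t 0.
  apply/(@cvgrPdist_le R R) => e e0; rewrite normr0 powR0 ?gt_eqF//.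
  near=> z; rewrite sub0r normrN ger0_norm ?powR_ge0//.
  have -> : e = (e `^ p^-1) `^ p by rewrite -powRrM mulVf ?gt_eqF// powRr1// ltW.
  apply: ge0_ler_powR; rewrite ?nnegrE ?powR_ge0 ?(ltW p0)//.
  near: z; apply/nbhs_ballP; exists (e `^ p^-1); first exact: powR_gt0.
  by move=> z /=; rewrite /ball/= sub0r normrN => /ltW.
have t1 : 0 < `|t| by rewrite normr_gt0.
exact: (@continuous_comp R R R Num.norm (fun t => t `^ p) t (@norm_continuous R R t)
  (is_derive_continuous _ _ _ _ (is_derive1_powR p t1))).
Unshelve. all: by end_near. Qed.

(** * From weak derivatives to the Schroedinger equation *)

Section weak_derivatives.
Context {R : realType} {N : nat}.
Notation rV := 'rV[R]_N.
Notation mu := (lebesgue_rV R N).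
Implicit Types (x y : rV) (r : R).

Lemma powR_Lnorm2 (f : rV -> R) :
  (Lnorm mu 2%:E (EFin \o f) `^ 2 = \int[mu]_y (f y ^+ 2)%:E)%E.
Proof.
rewrite powR_Lnorm ?pnatr_eq0//; apply: eq_integral => y _ /=.
by rewrite powR_mulrn// real_normK ?num_real.
Qed.

Lemma integrable_sqr (f : rV -> R) : L2R f ->
  mu.-integrable setT (EFin \o (fun y => f y ^+ 2)).
Proof.
move=> [mf ff]; apply/integrableP; split.
  by apply/measurable_EFinP; exact: measurable_funX.
under eq_integral do rewrite /= ger0_norm ?sqr_ge0//.
by rewrite -powR_Lnorm2 poweR_lty.
Qed.

(** With |f| <= 1 + f^2 and |g| <= K, the product is dominated by K f^2 + |g|. *)
Lemma integrable_L2R_mul (f g : rV -> R) x r : L2R f -> continuous g ->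
  supported_in x r g -> mu.-integrable setT (EFin \o (fun y => f y * g y)).
Proof.
move=> Lf cg sg; have [K K0 HK] := supported_bounded _ _ _ _ _ cg sg.
have ig : mu.-integrable setT (EFin \o (fun y => K * f y ^+ 2 + `|g y|)).
  have i1 := integrableZl measurableT K (integrable_sqr f Lf).
  have i2 := integrable_abse (supported_integrable _ _ _ _ _ cg sg).
  exact: (integrableD measurableT i1 i2).
apply: le_integrable ig => //.
  apply/measurable_EFinP; apply: measurable_funM; first by case: Lf.
  exact: continuous_measurable_rV.
move=> y _; rewrite /= lee_fin [leRHS]ger0_norm; last first.
  by rewrite addr_ge0// mulr_ge0// sqr_ge0.
rewrite normrM; have := HK y; have := normr_ge0 (g y); have := sqr_ge0 (`|f y| - 1).
have := normr_ge0 (f y).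
have -> : f y ^+ 2 = `|f y| ^+ 2 by rewrite real_normK ?num_real.
move: (`|f y|) (`|g y|) => a b; nra.
Qed.

(** The two weak derivatives are moved onto the bump one after the other, and their signs cancel.
    The almost everywhere equation is used only under the integral, where it trades the weak Hessian
    for the continuous [f]. *)
Lemma weak_laplacian_of_weak_partial (u f : rV -> R) (Du D2u : 'I_N -> rV -> R) :
  continuous u -> continuous f ->
  (forall i, weak_partialR i u (Du i)) ->
  (forall i, weak_partialR i (Du i) (D2u i)) -> (forall i, L2R (D2u i)) ->
  {ae mu, forall y, \sum_(i < N) D2u i y = f y} ->
  weak_laplacian u f.
Proof.
move=> cu cf Du1 Du2 LD aef; split => // x r r0.
have tf := test_function_radial_bump 1 x r r0.
have p2 i : partial i (partial i (radial_bump 1 x r)) = partial2_bump x r i.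
  by apply/funext => y; case: (is_derive_partial_bump x r i y).
have i1 i : mu.-integrable setT (EFin \o (fun y => u y * partial2_bump x r i y)).
  apply: (supported_integrable_mul _ _ x r) => //; first exact: continuous_partial2_bump.
  move=> y ny; rewrite /partial2_bump !radial_bump_supported//.
  by rewrite !(mulr0, addr0).
have cb := continuous_radial_bump 1 x r.
have sb := radial_bump_supported 1 x r r0.
have i2 i : mu.-integrable setT (EFin \o (fun y => D2u i y * radial_bump 1 x r y)).
  exact: (integrable_L2R_mul _ _ x r).
transitivity (\sum_(i < N) \int[mu]_y (u y * partial2_bump x r i y)).
  rewrite -(Rintegral_sum _ _ _ _ _ _ i1).2; apply: eq_Rintegral => y _.
  by rewrite -mulr_sumr sum_partial2_bump.
transitivity (\sum_(i < N) \int[mu]_y (D2u i y * radial_bump 1 x r y)).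
  apply: eq_bigr => i _; rewrite -p2 Du1; last exact: test_function_partial.
  by rewrite Du2// opprK.
have [i3 <-] := Rintegral_sum _ _ _ _ _ _ i2.
congr fine; apply: ae_eq_integral => //.
- by case/integrableP: i3.
- by have /integrableP[] := supported_integrable_mul f _ x r cf cb sb.
apply: filterS aef => y fy _ /=; congr EFin.
by rewrite -fy mulr_suml.
Qed.

Lemma continuous_powR_norm (p : R) : 0 <= p ->
  continuous (fun y : rV => eucl_norm y `^ p).
Proof.
rewrite le_eqVlt => /predU1P[<-|p0].
  by under eq_fun do rewrite powRr0; exact: continuous_const.
under eq_fun do rewrite -[eucl_norm _]ger0_norm ?sqrtr_ge0//.
move=> y; apply: (@continuous_comp _ _ _ (@eucl_norm R N) (fun t => `|t| `^ p)).
  exact: continuous_eucl_norm.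
exact: continuous_powR_abs.
Qed.

Definition eigen_re (alpha beta l : R) y : R :=
  (coef_V beta y + l) / coef_a alpha y.

Definition eigen_im (alpha l : R) y : R := l / coef_a alpha y.

Lemma coef_a_ge1 alpha y : 1 <= coef_a alpha y.
Proof. by rewrite /coef_a lerDl powR_ge0. Qed.

Lemma continuous_coef_aV alpha : 0 <= alpha ->
  continuous (fun y => (coef_a alpha y)^-1).
Proof.
move=> a0 y; apply: continuousV.
  by rewrite gt_eqF// (lt_le_trans ltr01)// coef_a_ge1.
by apply: continuous_add; [exact: continuous_const|exact: continuous_powR_norm].
Qed.

Lemma Re_sum n (F : 'I_n -> R[i]) :
  complex.Re (\sum_(i < n) F i) = \sum_(i < n) complex.Re (F i).
Proof. by apply: (big_morph (@complex.Re R)) => // -[a b] [c d]. Qed.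

Lemma Im_sum n (F : 'I_n -> R[i]) :
  complex.Im (\sum_(i < n) F i) = \sum_(i < n) complex.Im (F i).
Proof. by apply: (big_morph (@complex.Im R)) => // -[a b] [c d]. Qed.

Lemma eigenfunction_schroedinger (alpha beta : R) (lambda : R[i]) (psi : rV -> R[i]) :
  0 <= alpha -> 0 <= beta -> continuousC psi ->
  A2_graph alpha beta psi (fun y => lambda * psi y) ->
  complex_schroedinger (eigen_re alpha beta (complex.Re lambda))
    (eigen_im alpha (complex.Im lambda))
    (@complex.Re R \o psi) (@complex.Im R \o psi).
Proof.
move=> a0 b0 [c1 c2] [Du [D2u [[[_ HDu HD2u] _ _ _] eqn]]].
have cV : continuous (coef_V beta : rV -> R) by exact: continuous_powR_norm.
have ca := continuous_coef_aV alpha a0.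
have cA l : continuous (eigen_re alpha beta l).
  by apply: continuous_mul => //; apply: continuous_add => //; exact: continuous_const.
have cB l : continuous (eigen_im alpha l).
  by apply: continuous_mul => //; exact: continuous_const.
have a1 (y : rV) : coef_a alpha y != 0.
  by rewrite gt_eqF// (lt_le_trans ltr01)// coef_a_ge1.
split.
- apply: (weak_laplacian_of_weak_partial _ _ (fun i => @complex.Re R \o Du i)
    (fun i => @complex.Re R \o D2u i i)) => //.
  + apply: (continuous_add _ (fun y => - (_ * _))); first exact: continuous_mul.
    by apply: continuous_opp; exact: continuous_mul.
  + by move=> i; have [_ []] := HDu i.
  + by move=> i; have [_ []] := HD2u i i.
  + by move=> i; have [[]] := HD2u i i.
  apply: filterS eqn => y; rewrite /laplacian /eigen_re /eigen_im /= -Re_sum.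
  case: (\sum_(i < N) _) => l1 l2; case: (psi y) => p1 p2; case: lambda => m1 m2.
  move=> /(congr1 (@complex.Re R)) /=; rewrite !mul0r !subr0 => h.
  apply: (mulfI (a1 y)); transitivity (coef_V beta y * p1 + (m1 * p1 - m2 * p2)).
    by rewrite -h; ring.
  by field.
- apply: (weak_laplacian_of_weak_partial _ _ (fun i => @complex.Im R \o Du i)
    (fun i => @complex.Im R \o D2u i i)) => //.
  + by apply: continuous_add; exact: continuous_mul.
  + by move=> i; have [_ []] := HDu i.
  + by move=> i; have [_ []] := HD2u i i.
  + by move=> i; have [[]] := HD2u i i.
  apply: filterS eqn => y; rewrite /laplacian /eigen_re /eigen_im /= -Im_sum.
  case: (\sum_(i < N) _) => l1 l2; case: (psi y) => p1 p2; case: lambda => m1 m2.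
  move=> /(congr1 (@complex.Im R)) /=; rewrite !mul0r !addr0 => h.
  apply: (mulfI (a1 y)); transitivity (coef_V beta y * p2 + (m1 * p2 + m2 * p1)).
    by rewrite -h; ring.
  by field.
Qed.

Lemma normc_modulus (psi : rV -> R[i]) y :
  normc (psi y) = modulus (@complex.Re R \o psi) (@complex.Im R \o psi) y.
Proof. by rewrite /modulus /=; case: (psi y). Qed.

Lemma L2norm1_modulus (psi : rV -> R[i]) : continuousC psi -> L2norm psi = 1%E ->
  let W := modulus (@complex.Re R \o psi) (@complex.Im R \o psi) in
  mu.-integrable setT (EFin \o (fun y => W y ^+ 2)) /\ \int[mu]_y (W y ^+ 2) = 1.
Proof.
move=> [c1 c2] n1 W.
have E : (\int[mu]_y (W y ^+ 2)%:E = 1)%E.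
  rewrite -powR_Lnorm2 (_ : EFin \o W = fun y => (normc (psi y))%:E).
    by rewrite [Lnorm _ _ _]n1 poweR1r.
  by apply/funext => y; rewrite normc_modulus.
split; last by rewrite /Rintegral E.
apply/integrableP; split.
  apply/measurable_EFinP; apply: measurable_funX.
  by apply: continuous_measurable_rV; exact: continuous_modulus.
under eq_integral do rewrite /= ger0_norm ?sqr_ge0//.
by rewrite E ltry.
Qed.

End weak_derivatives.

(** * The WKB supersolution *)

Lemma one_add_powR_le {R : realType} (alpha r : R) : alpha < 2 -> 1 <= r ->
  1 + r `^ alpha <= 2 * r ^+ 2.
Proof.
move=> alpha2 r1; have r0 : 0 <= r by exact: le_trans ler01 r1.
have : r `^ alpha <= r ^+ 2 by rewrite -powR_mulrn// ler_powR// ltW.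
have : 1 <= r ^+ 2 by rewrite exprn_ege1.
lra.
Qed.

Section wkb.
Context {R : realType} (alpha beta : R).
Implicit Types (r s : R).

Definition wkb_rate r : R := r `^ (beta / 2) / (1 + r `^ alpha) `^ (1 / 2).

Definition wkb_phase r : R := \int[lebesgue_measure]_(s in `[1, r]) wkb_rate s.

(** The logarithmic derivative of a = 1 + r^alpha is alpha tt / r. As tt lies in [0, 1] and tt' =
    alpha tt (1 - tt) / r, all derivatives of the profile are expressed through it. *)
Let tt r : R := r `^ alpha / (1 + r `^ alpha).

(** Chosen so that r^(beta/2) = r (r^sig)^2; then [wkb_rate r * hh r] is r^sig / sqrt a. *)
Let sig : R := (beta - 2) / 4.

Lemma powRE r (p : R) : 0 < r -> r `^ p = expR (p * ln r).
Proof. by move=> r0; rewrite /powR gt_eqF. Qed.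

Let den_gt0 r : 0 < 1 + r `^ alpha.
Proof. by rewrite ltr_wpDr// powR_ge0. Qed.

Lemma wkb_rateE r : 0 < r ->
  wkb_rate r = expR (beta / 2 * ln r - 2^-1 * ln (1 + r `^ alpha)).
Proof.
by move=> r0; rewrite /wkb_rate !powRE// div1r expRD expRN.
Qed.

Lemma wkb_rate_gt0 r : 0 < r -> 0 < wkb_rate r.
Proof. by move=> r0; rewrite wkb_rateE// expR_gt0. Qed.

Lemma sqr_wkb_rate r : 0 < r -> wkb_rate r ^+ 2 = r `^ beta / (1 + r `^ alpha).
Proof.
move=> r0; rewrite expr_div_n; congr (_ / _); rewrite -powR_mulrn ?powR_ge0// -powRrM.
  by congr (_ `^ _); field.
by rewrite div1r mulVf// powRr1// ltW.
Qed.

Let is_derive_powR r (p : R) : 0 < r ->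
  is_derive r 1 (fun s : R => s `^ p) (p * r `^ p / r).
Proof.
move=> r0; apply: is_derive_val (is_derive1_powR p r0) _.
by rewrite powRB ?(gt_eqF r0) ?implybT// (powRr1 (ltW r0)) mulrA.
Qed.

Let is_derive_lnD r : 0 < r ->
  is_derive r 1 (fun s => ln (1 + s `^ alpha)) (alpha * tt r / r).
Proof.
move=> r0; have d := is_derive_add _ _ _ _ _ _ (is_derive_const 1 r 1) (is_derive_powR r alpha r0).
apply: is_derive_val (is_derive_compose _ _ _ _ _ _ d (is_derive1_ln (den_gt0 r))) _.
by rewrite add0r /tt; field; rewrite !gt_eqF.
Qed.

Let is_derive_tt r : 0 < r -> is_derive r 1 tt (alpha * tt r * (1 - tt r) / r).
Proof.
move=> r0; have dp := is_derive_powR r alpha r0.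
have d := is_derive_add _ _ _ _ _ _ (is_derive_const 1 r 1) dp.
have dn : 1 + r `^ alpha != 0 by rewrite gt_eqF.
apply: is_derive_val (is_derive_mul _ _ _ _ _ _ dp (is_derive_inv _ _ _ _ d dn)) _.
by rewrite add0r /tt; field; rewrite dn gt_eqF.
Qed.

Lemma is_derive_wkb_rate r : 0 < r ->
  is_derive r 1 wkb_rate (wkb_rate r * (beta - alpha * tt r) / (2 * r)).
Proof.
move=> r0.
apply: (is_derive_near _ (fun s => expR (beta / 2 * ln s - 2^-1 * ln (1 + s `^ alpha)))).
  by near=> s; rewrite wkb_rateE//; near: s; exact: lt_nbhsr.
have d := is_derive_sub _ _ _ _ _ _ (is_derive_scale (beta / 2) _ _ _ _ (is_derive1_ln r0))
  (is_derive_scale 2^-1 _ _ _ _ (is_derive_lnD r r0)).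
apply: is_derive_val (is_derive_compose _ _ _ _ _ _ d (is_derive_expR _)) _.
by rewrite wkb_rateE//; field; rewrite gt_eqF.
Unshelve. all: by end_near. Qed.

Lemma integrable_wkb_rate r :
  lebesgue_measure.-integrable `[1, r] (EFin \o wkb_rate).
Proof.
apply: continuous_compact_integrable; first exact: segment_compact.
apply: derivable_within_continuous => s; rewrite in_itv/= => /andP[s1 _].
by case: (is_derive_wkb_rate s (lt_le_trans ltr01 s1)).
Qed.

Lemma is_derive_wkb_phase r : 1 < r -> is_derive r 1 wkb_phase (wkb_rate r).
Proof.
move=> r1; have r0 := lt_trans ltr01 r1.
(* The integral is taken over a longer interval so that [r] is an interior point. *)
have r2 : r < r + 1 by rewrite ltrDl.
have [d e] := continuous_FTC1_closed r2 (integrable_wkb_rate (r + 1)) r1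
  (is_derive_continuous _ _ _ _ (is_derive_wkb_rate r r0)).
by apply: DeriveDef; [exact: d|rewrite -derive1E].
Qed.

Lemma wkb_phase_le r s : r <= s -> wkb_phase r <= wkb_phase s.
Proof.
move=> rs; rewrite /wkb_phase /Rintegral fine_le//.
- exact: integrable_fin_num (integrable_wkb_rate r).
- exact: integrable_fin_num (integrable_wkb_rate s).
apply: ge0_subset_integral => //.
- by case/integrableP: (integrable_wkb_rate s).
- move=> t; rewrite /= in_itv/= => /andP[t1 _]; rewrite lee_fin.
  exact/ltW/wkb_rate_gt0/(lt_le_trans ltr01 t1).
- by move=> t /=; rewrite !in_itv/= => /andP[-> /le_trans ->].
Qed.

Variable m : R.

(** The derivative of the correction -r^(-sig)/sig in the exponent. *)
Let hh r : R := (r * r `^ sig)^-1.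

(* The WKB profile [r^(-m) p^(-1/4) exp(-int sqrt p)] for [p = V/a], times
   [exp(-r^(-sig)/sig)]: this bounded correction absorbs both the error of the
   WKB approximation and the eigenvalue. *)
Definition wkb_log r : R :=
  - m * ln r - beta / 4 * ln r + 4^-1 * ln (1 + r `^ alpha) - wkb_phase r
  - sig^-1 * r `^ (- sig).

Definition wkb r : R := expR (wkb_log r).

Definition wkb_log1 r : R :=
  - m / r - (beta - alpha * tt r) / (4 * r) - wkb_rate r + hh r.

Definition wkb_log2 r : R :=
  m / r ^+ 2 + (beta - alpha * tt r) / (4 * r ^+ 2)
  + alpha * (alpha * tt r * (1 - tt r)) / (4 * r ^+ 2)
  - wkb_rate r * (beta - alpha * tt r) / (2 * r) - (sig + 1) * hh r / r.

Hypothesis beta2 : 2 < beta.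

Let sig0 : 0 < sig.
Proof. by rewrite divr_gt0// subr_gt0. Qed.

Lemma is_derive_wkb_log r : 1 < r -> is_derive r 1 wkb_log (wkb_log1 r).
Proof.
move=> r1; have r0 := lt_trans ltr01 r1.
have d1 := is_derive_scale (- m) _ _ _ _ (is_derive1_ln r0).
have d2 := is_derive_scale (beta / 4) _ _ _ _ (is_derive1_ln r0).
have d3 := is_derive_scale 4^-1 _ _ _ _ (is_derive_lnD r r0).
have d4 := is_derive_scale sig^-1 _ _ _ _ (is_derive_powR r (- sig) r0).
apply: is_derive_val (is_derive_sub _ _ _ _ _ _ (is_derive_sub _ _ _ _ _ _
  (is_derive_add _ _ _ _ _ _ (is_derive_sub _ _ _ _ _ _ d1 d2) d3)
  (is_derive_wkb_phase r r1)) d4) _.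
rewrite /wkb_log1 /hh powRN; field.
by rewrite !gt_eqF// powR_gt0.
Qed.

Lemma is_derive_wkb_log1 r : 1 < r -> is_derive r 1 wkb_log1 (wkb_log2 r).
Proof.
move=> r1; have r0 := lt_trans ltr01 r1.
have rn0 : r != 0 by rewrite gt_eqF.
have dV : is_derive r 1 (fun s : R => s^-1) (- 1 / r ^+ 2).
  exact: is_derive_inv (is_derive_id _ _) rn0.
have d1 := is_derive_scale (- m) _ _ _ _ dV.
have dt := is_derive_sub _ _ _ _ _ _ (is_derive_const beta r 1)
  (is_derive_scale alpha _ _ _ _ (is_derive_tt r r0)).
have d4r : is_derive r 1 (fun s : R => (4 * s)^-1) (- (4 * 1) / (4 * r) ^+ 2).
  apply: is_derive_inv; last by rewrite mulf_neq0.
have d2 := is_derive_mul _ _ _ _ _ _ dt d4r.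
have dp : is_derive r 1 (fun s : R => s * s `^ sig) (1 * r `^ sig + r * (sig * r `^ sig / r)).
  exact: (is_derive_mul _ _ _ _ _ _ (is_derive_id r 1) (is_derive_powR r sig r0)).
have pn0 : r * r `^ sig != 0 by rewrite gt_eqF// mulr_gt0// powR_gt0.
have d3 := is_derive_inv _ _ _ _ dp pn0.
apply: is_derive_val (is_derive_add _ _ _ _ _ _ (is_derive_sub _ _ _ _ _ _
  (is_derive_sub _ _ _ _ _ _ d1 d2) (is_derive_wkb_rate r r0)) d3) _.
rewrite /wkb_log2 /hh; field.
by rewrite rn0 gt_eqF// powR_gt0.
Qed.

Lemma is_derive_wkb r : 1 < r -> is_derive r 1 wkb (wkb r * wkb_log1 r).
Proof.
move=> r1; exact: is_derive_compose (is_derive_wkb_log r r1) (is_derive_expR _).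
Qed.

Lemma is_derive_wkb1 r : 1 < r ->
  is_derive r 1 (fun s => wkb s * wkb_log1 s)
    (wkb r * (wkb_log1 r ^+ 2 + wkb_log2 r)).
Proof.
move=> r1; apply: is_derive_val (is_derive_mul _ _ _ _ _ _
  (is_derive_wkb r r1) (is_derive_wkb_log1 r r1)) _.
by ring.
Qed.

Hypothesis alpha0 : 0 <= alpha.
Hypothesis alpha2 : alpha < 2.

Let X r := r `^ sig.

Let X_ge1 r : 1 <= r -> 1 <= X r.
Proof. by move=> r1; rewrite -(powRr0 r) ler_powR// ltW. Qed.

Lemma wkb_supersolution (l r : R) : 0 <= l -> 1 < r -> 1 <= m ->
  l + beta ^+ 2 / 8 + beta / 2 + 4 <= r `^ sig ->
  wkb_log1 r ^+ 2 + wkb_log2 r + 2 * m / r * wkb_log1 r <=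
    (r `^ beta - l) / (1 + r `^ alpha).
Proof.
move=> l0 r1 m1; rewrite -/(X r) => Xl.
have r0 := lt_trans ltr01 r1; have rn0 : r != 0 by rewrite gt_eqF.
have X0 : 0 < X r by exact: powR_gt0.
have t0 : 0 <= tt r by rewrite divr_ge0 ?powR_ge0// ltW.
have t1 : tt r <= 1.
  by rewrite ler_pdivrMr// mul1r lerDr.
rewrite mulrBl -sqr_wkb_rate//.
set P := wkb_rate r; set S := (1 + r `^ alpha) `^ (1 / 2).
have S0 : 0 < S by exact: powR_gt0.
have S2 : S ^+ 2 = 1 + r `^ alpha.
  by rewrite -powR_mulrn ?powR_ge0// -powRrM div1r mulVf// powRr1// ltW.
have PE : P = r * X r ^+ 2 / S.
  rewrite /P /wkb_rate -/S; congr (_ / _).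
  rewrite /X -powR_mulrn ?powR_ge0// -powRrM -[X in _ = X * _](powRr1 (ltW r0)).
  rewrite -powRD ?(gt_eqF r0) ?implybT//.
  by congr (_ `^ _); rewrite /sig; field.
have P0 : 0 < P by exact: wkb_rate_gt0.
have hE : hh r = (r * X r)^-1 by [].
have h0 : 0 < hh r by rewrite hE invr_gt0 mulr_gt0.
have Ph : P * hh r = X r / S by rewrite PE hE; field; rewrite !gt_eqF.
have S1 : 1 <= S by rewrite -(powRr0 (1 + r `^ alpha)) ler_powR// lerDl powR_ge0.
have Sr : S <= 2 * r.
  rewrite -ler_sqr ?nnegrE ?mulr_ge0 ?(ltW r0) ?(ltW S0)// S2.
  rewrite (le_trans (one_add_powR_le alpha r alpha2 (ltW r1)))//.
  by rewrite exprMn ler_wpM2r ?sqr_ge0// expr2; lra.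
have rV1 : r^-1 <= 1 by rewrite invf_le1// ltW.
have rV0 : 0 < r^-1 by rewrite invr_gt0.
(* beta^2/16 + beta/4 + 1 bounds the terms in beta - alpha tt and alpha^2 tt (1 - tt) / 4; the last
   1 pays for hh^2 <= 1/r^2. The threshold in the hypothesis on r^sig is l + 2 C1. *)
pose C1 := beta ^+ 2 / 16 + beta / 4 + 2.
have Ph1 : C1 / r ^+ 2 <= P * hh r.
  rewrite Ph; apply: (@le_trans _ _ (X r / (2 * r))); last first.
    by rewrite ler_wpM2l ?(ltW X0)// lef_pV2 ?posrE ?mulr_gt0.
  have -> : X r / (2 * r) = X r / 2 * r^-1 by field.
  rewrite expr2 invfM mulrA ler_wpM2r ?(ltW rV0)//.
  apply: (@le_trans _ _ C1); last by rewrite /C1; lra.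
  by rewrite ler_piMr// /C1; move: beta2 (sqr_ge0 beta); lra.
have Ph2 : l / S ^+ 2 <= P * hh r.
  rewrite Ph expr2 invfM mulrA ler_wpM2r ?invr_ge0 ?(ltW S0)//.
  rewrite ler_pdivrMr//; apply: (@le_trans _ _ (X r)).
    by apply: le_trans Xl; move: beta2 (sqr_ge0 beta); lra.
  by rewrite ler_peMr// ltW.
have hr : hh r <= r^-1.
  rewrite hE invfM ler_piMr ?(ltW rV0)// invf_le1//.
  exact: X_ge1 (ltW r1).
(* All terms in P/r have cancelled. The hypothesis [1 <= m] gives m^2 - m >= 0, so that term
   helps. *)
have -> : wkb_log1 r ^+ 2 + wkb_log2 r + 2 * m / r * wkb_log1 r =
  P ^+ 2 - 2 * (P * hh r) + ((beta - alpha * tt r) ^+ 2 / 16 + (beta - alpha * tt r) / 4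
    + alpha ^+ 2 * (tt r * (1 - tt r)) / 4) / r ^+ 2 + hh r ^+ 2
  - (m ^+ 2 - m) / r ^+ 2 - (beta - alpha * tt r) / 2 * hh r / r - (sig + 1) * hh r / r.
  by rewrite /wkb_log1 /wkb_log2 -/P; field.
rewrite -S2.
have at0 : 0 <= alpha * tt r by exact: mulr_ge0.
have at1 : alpha * tt r <= alpha by rewrite ler_piMr.
have bt : 0 <= beta - alpha * tt r by move: beta2 alpha2 at1; lra.
have e1 : 0 <= (m ^+ 2 - m) / r ^+ 2.
  by rewrite divr_ge0 ?sqr_ge0// subr_ge0 expr2 ler_peMr// (le_trans ler01).
have e2 : 0 <= (beta - alpha * tt r) / 2 * hh r / r.
  by rewrite !mulr_ge0// ltW.
have e3 : 0 <= (sig + 1) * hh r / r.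
  by rewrite !mulr_ge0 ?addr_ge0// ltW.
have e4 : hh r ^+ 2 <= 1 / r ^+ 2.
  by rewrite div1r -exprVn lerXn2r ?nnegrE// ltW.
have e5 : ((beta - alpha * tt r) ^+ 2 / 16 + (beta - alpha * tt r) / 4
    + alpha ^+ 2 * (tt r * (1 - tt r)) / 4) / r ^+ 2 <= (C1 - 1) / r ^+ 2.
  rewrite ler_wpM2r ?invr_ge0 ?sqr_ge0// /C1.
  have f1 : (beta - alpha * tt r) ^+ 2 <= beta ^+ 2.
    by rewrite lerXn2r ?nnegrE//; lra.
  have f2 : alpha ^+ 2 * (tt r * (1 - tt r)) <= 4.
    have g1 : alpha ^+ 2 <= 4 by move: alpha0 alpha2; rewrite expr2; nra.
    have g2 : tt r * (1 - tt r) <= 1 by nra.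
    have g3 : 0 <= tt r * (1 - tt r) by rewrite mulr_ge0// subr_ge0.
    have := sqr_ge0 alpha; nra.
  lra.
have e6 : (C1 - 1) / r ^+ 2 + 1 / r ^+ 2 = C1 / r ^+ 2 by rewrite -mulrDl subrK.
move: e1 e2 e3 e4 e5 e6 Ph1 Ph2; set z1 := (m ^+ 2 - m) / _.
set z2 := _ / 2 * hh r / r; set z3 := (sig + 1) * hh r / r.
set z4 := _ / r ^+ 2; set z5 := _ / r ^+ 2; set z6 := _ / r ^+ 2.
by set z7 := _ / r ^+ 2; set z8 := _ / S ^+ 2; set z9 := P * hh r; lra.
Qed.

End wkb.

(** * Comparison outside a ball *)

Section comparison.
Context {R : realType} {N : nat}.
Notation rV := 'rV[R]_N.
Implicit Types (x y : rV) (r : R).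

Lemma eucl_norm_ge0 y : 0 <= eucl_norm y.
Proof. exact: sqrtr_ge0. Qed.

Lemma annulus_compact (r s : R) : compact [set y : rV | r <= eucl_norm y <= s].
Proof.
apply: (subclosed_compact _ (cube_compact R N 0 s)).
  rewrite (_ : [set y | _] = @eucl_norm R N @^-1` `[r, s]%classic).
    apply: closed_comp => [y _|]; first exact: continuous_eucl_norm.
    exact: itv_closed.
  by apply/seteqP; split=> y /=; rewrite in_itv.
move=> y /andP[_ ys]; apply: rad_le_cube; first exact: le_trans (eucl_norm_ge0 y) ys.
by rewrite -sqr_eucl_norm lerXn2r ?nnegrE ?eucl_norm_ge0// (le_trans (eucl_norm_ge0 y)).
Qed.

(** A positive maximum of |u| - g over an annulus is interior, by the bounds on the inner sphere and
    far away. There the rotated solution is touched from above by g plus a constant, which forces A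
    |u| <= A g although A > 0 and |u| > g. *)
Lemma exterior_comparison (A B u1 u2 : rV -> R) (g g1 g2 : R -> R) (r0 : R) :
  (0 < N)%N -> 1 < r0 -> complex_schroedinger A B u1 u2 ->
  (forall r, 1 < r -> is_derive r 1 g (g1 r)) ->
  (forall r, 1 < r -> is_derive r 1 g1 (g2 r)) ->
  (forall r, r0 <= r -> 0 < g r) ->
  (forall y, r0 < eucl_norm y -> 0 < A y /\
    g2 (eucl_norm y) + (N%:R - 1) / eucl_norm y * g1 (eucl_norm y) <=
      A y * g (eucl_norm y)) ->
  (forall y, eucl_norm y = r0 -> modulus u1 u2 y <= g r0) ->
  (exists s, forall y, s <= eucl_norm y -> modulus u1 u2 y <= g (eucl_norm y)) ->
  forall y, r0 <= eucl_norm y -> modulus u1 u2 y <= g (eucl_norm y).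
Proof.
move=> N0 r01 su dg dg1 g0 super bd [s far] z r0z.
rewrite leNgt; apply/negP => gz.
(* The outer radius is at least [s], where [far] applies, and large enough for the annulus to
   contain [z]. *)
pose W := modulus u1 u2; pose K := [set y : rV | r0 <= eucl_norm y <= Num.max s (eucl_norm z)].
have [cu1 cu2] : continuous u1 /\ continuous u2 by case: su => [[? _ _] [? _ _]].
have cW : continuous W by exact: continuous_modulus.
pose F y := W y - g (eucl_norm y).
have Kz : K z by rewrite /K/= r0z le_max lexx orbT.
have cF : {within K, continuous F}.
  apply: continuous_in_subspaceT => y; rewrite inE => /andP[r0y _].
  have cg : {for y, continuous (g \o @eucl_norm R N)}.
    apply: continuous_comp; first exact: continuous_eucl_norm.
    exact: is_derive_continuous (dg _ (lt_le_trans r01 r0y)).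
  exact: (continuousB (cW y) cg).
have [|c] := @compact_EVT_max _ R F K _ (annulus_compact _ _) cF; first by exists z.
rewrite inE => Kc Fc.
have Fc0 : 0 < F c.
  by apply: lt_le_trans (Fc z _); rewrite ?inE// subr_gt0.
have /andP[r0c cs] := Kc.
have gWc : g (eucl_norm c) < W c by rewrite -subr_gt0.
have {r0c}r0c : r0 < eucl_norm c.
  rewrite lt_neqAle r0c andbT; apply/eqP => e.
  by have := bd c (esym e); rewrite leNgt e gWc.
have {cs}cs : eucl_norm c < Num.max s (eucl_norm z).
  rewrite lt_neqAle cs andbT; apply/eqP => e.
  by have := far c; rewrite e le_max lexx => /(_ isT); rewrite leNgt -e gWc.
have r1c := lt_trans r01 r0c.
have gc0 := g0 _ (ltW r0c).
have [v [f [vf vc fc vW _]]] := phase_rotation A B u1 u2 c su (lt_trans gc0 gWc).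
(* The shift by [F c] makes the profile touch [v] at [c] and leaves its derivatives unchanged. *)
have := weak_laplacian_radial_touch v f (fun r => g r + F c) g1 (g2 (eucl_norm c)) c vf N0
  (lt_trans ltr01 r1c).
have [Ac sc] := super c r0c.
move=> H; have : f c <= A c * g (eucl_norm c).
  apply: le_trans sc; apply: H.
  - near=> r; apply: is_derive_val (is_derive_add _ _ _ _ _ _ (dg r _) (is_derive_const _ _ _)) _.
      by near: r; exact: lt_nbhsr.
    by rewrite addr0.
  - exact: dg1.
  - by rewrite vc /F addrC subrK.
  have nK : \forall y \near c, r0 < eucl_norm y < Num.max s (eucl_norm z).
    have n1 : \forall y \near c, r0 < eucl_norm y by exact: (cvgr_gt _ (continuous_eucl_norm c)).
    have n2 : \forall y \near c, eucl_norm y < Num.max s (eucl_norm z).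
      exact: (cvgr_lt _ (continuous_eucl_norm c)).
    by near=> y; apply/andP; split; near: y.
  near=> y; apply: le_trans (vW y) _; rewrite -lerBlDl.
  apply: Fc; rewrite inE /K/=.
  by have /andP[h1 h2] : r0 < eucl_norm y < Num.max s (eucl_norm z) by [near: y]; rewrite !ltW.
by rewrite fc ler_pM2l// leNgt gWc.
Unshelve. all: by end_near. Qed.

End comparison.

Lemma powR_ge_threshold (R : realType) (p c : R) : 0 < p -> 0 <= c ->
  exists2 r0 : R, 1 < r0 & forall r, r0 <= r -> c <= r `^ p.
Proof.
move=> p0 c0; exists (c `^ p^-1 + 2).
  by rewrite ltr_wpDl ?powR_ge0// ltr1n.
move=> r h; have -> : c = (c `^ p^-1) `^ p by rewrite -powRrM mulVf ?gt_eqF// powRr1.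
apply: ge0_ler_powR; rewrite ?nnegrE ?powR_ge0 ?(ltW p0)//.
  by apply: le_trans h; rewrite addr_ge0// powR_ge0.
by apply: le_trans h; rewrite lerDl.
Qed.

(** * Growth and decay of eigenfunctions *)

Section decay.
Context {R : realType} {N : nat} (alpha beta : R).
Notation rV := 'rV[R]_N.
Implicit Types (x y : rV) (r : R).
Hypothesis N2 : (2 < N)%N.
Hypothesis alpha0 : 0 <= alpha.
Hypothesis alpha2 : alpha < 2.
Hypothesis beta2 : 2 < beta.

Let m : R := (N%:R - 1) / 2.

Let m_ge1 : 1 <= m.
Proof.
have : 3 <= N%:R :> R by rewrite ler_nat.
by rewrite /m; lra.
Qed.

(** This supplies the [Q] of [local_bound]; [1 <= D] ensures [1 <= Q]. *)
Lemma eigen_coef_bound (l1 l2 : R) : exists (D : R) (b : nat), 1 <= D /\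
  forall x y, cube x 1 y ->
    `|eigen_re alpha beta l1 y| + `|eigen_im alpha l2 y| <= D * (1 + eucl_norm x) ^+ b.
Proof.
(* [b.+1] is an integer above beta, so V is bounded by a natural power of N (1 + |x|) on the unit
   cube. *)
pose b := Num.truncn beta.
exists (N%:R ^+ b.+1 + `|l1| + `|l2|), b.+1; split.
  rewrite -addrA ler_wpDr ?addr_ge0// exprn_ege1// ler1n.
  exact: leq_trans N2.
move=> x y xy; set rho := 1 + eucl_norm x.
have rho1 : 1 <= rho by rewrite lerDl eucl_norm_ge0.
have a1 := coef_a_ge1 alpha y; have a0 := lt_le_trans ltr01 a1.
have yN : eucl_norm y <= N%:R * rho.
  have c0 : cube 0 rho y.
    move=> i; rewrite mxE subr0 -[y ord0 i](subrK (x ord0 i)).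
    rewrite (le_trans (ler_normD _ _))// /rho lerD//.
    rewrite -ler_sqr ?nnegrE ?eucl_norm_ge0// real_normK ?num_real// sqr_eucl_norm.
    by have := sqr_coord_le_rad 0 x i; rewrite mxE subr0.
  rewrite -ler_sqr ?nnegrE ?eucl_norm_ge0 ?mulr_ge0// ?(le_trans ler01)//.
  rewrite sqr_eucl_norm (le_trans (cube_rad _ _ _ c0))// exprMn ler_wpM2r ?sqr_ge0//.
  by rewrite expr2 ler_peMr// ler1n (leq_trans _ N2).
have V1 : coef_V beta y <= N%:R ^+ b.+1 * rho ^+ b.+1.
  rewrite -exprMn /coef_V.
  have n1 : 1 <= N%:R * rho by rewrite mulr_ege1// ler1n (leq_trans _ N2).
  apply: (@le_trans _ _ ((N%:R * rho) `^ beta)).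
    by apply: ge0_ler_powR; rewrite ?nnegrE ?eucl_norm_ge0 ?(le_trans ler01 n1)//; move: beta2; lra.
  rewrite -powR_mulrn ?(le_trans ler01 n1)// ler_powR//.
  by apply/ltW/truncnS_gt.
have V0 : 0 <= coef_V beta y by exact: powR_ge0.
have rb : 1 <= rho ^+ b.+1 by rewrite exprn_ege1.
rewrite /eigen_re /eigen_im !normrM normfV (gtr0_norm a0) -mulrDl.
rewrite ler_pdivrMr//; apply: (@le_trans _ _ (coef_V beta y + `|l1| + `|l2|)).
  by rewrite lerD2r (le_trans (ler_normD _ _))// ger0_norm.
apply: (@le_trans _ _ ((N%:R ^+ b.+1 + `|l1| + `|l2|) * rho ^+ b.+1)).
  rewrite !mulrDl; apply: lerD; first apply: lerD => //.
    by rewrite ler_peMr.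
  by rewrite ler_peMr.
by rewrite ler_peMr// mulr_ge0 ?addr_ge0 ?exprn_ge0// (le_trans ler01).
Qed.

Lemma eigen_polynomial_bound (l1 l2 : R) : exists (C : R) (k : nat), 0 < C /\
  forall u1 u2, complex_schroedinger (eigen_re alpha beta l1) (eigen_im alpha l2) u1 u2 ->
    (lebesgue_rV R N).-integrable setT (EFin \o (fun y => modulus u1 u2 y ^+ 2)) ->
    \int[lebesgue_rV R N]_y (modulus u1 u2 y ^+ 2) <= 1 ->
    forall x, modulus u1 u2 x <= C * (1 + eucl_norm x) ^+ k.
Proof.
have [C C0 HC] := @local_bound R N (leq_trans (isT : (1 <= 3)%N) N2).
have [D [b [D1 HD]]] := eigen_coef_bound l1 l2.
have D0 : 0 < D by exact: lt_le_trans D1.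
exists (C * D ^+ N), (b * N)%N; split; first by rewrite mulr_gt0// exprn_gt0.
move=> u1 u2 su iW IW x.
rewrite -mulrA exprM -exprMn.
apply: (HC _ _ u1 u2 su iW IW x (D * (1 + eucl_norm x) ^+ b) _ (HD x)).
by rewrite mulr_ege1// exprn_ege1// lerDl eucl_norm_ge0.
Qed.

(** For r >= 1 one has 1 + r^alpha <= 2 r^alpha, so the factor a^(1/4) costs at most 2^(1/4) <= 2;
    the correction factor is at most 1. *)
Lemma wkb_le r : 1 <= r ->
  wkb alpha beta m r <=
    2 * (r `^ ((alpha - beta) / 4 - (N%:R - 1) / 2) * expR (- wkb_phase alpha beta r)).
Proof.
move=> r1; have r0 : 0 < r by exact: lt_le_trans r1.
rewrite (powRE r (_ / 4 - _) r0) -expRD -[X in _ <= X * _]lnK ?posrE// -expRD ler_expR /wkb_log.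
have h1 : 0 <= ((beta - 2) / 4)^-1 * r `^ (- ((beta - 2) / 4)).
  by rewrite mulr_ge0 ?powR_ge0// invr_ge0 divr_ge0// subr_ge0 ltW.
have a1 : 1 <= r `^ alpha by rewrite -(powRr0 r) ler_powR.
have h2 : ln (1 + r `^ alpha) <= ln 2 + alpha * ln r.
  rewrite -ln_powR -lnM ?posrE ?powR_gt0// ler_ln ?posrE ?mulr_gt0 ?powR_gt0//; last first.
    by rewrite ltr_pwDl// powR_ge0.
  by move: a1; lra.
have h3 : 0 <= ln 2 :> R by apply: ln_ge0; rewrite ler1n.
rewrite /m; move: h1 h2 h3; set z := _ * r `^ _; move: (ln (1 + _)) (ln 2) (ln r) => a b c; lra.
Qed.

Lemma wkb_decay (l1 l2 : R) : exists2 C : R, 0 < C &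
  forall u1 u2, complex_schroedinger (eigen_re alpha beta l1) (eigen_im alpha l2) u1 u2 ->
    (lebesgue_rV R N).-integrable setT (EFin \o (fun y => modulus u1 u2 y ^+ 2)) ->
    \int[lebesgue_rV R N]_y (modulus u1 u2 y ^+ 2) <= 1 ->
    forall x, 1 <= eucl_norm x ->
      modulus u1 u2 x <= C * (eucl_norm x `^ ((alpha - beta) / 4 - (N%:R - 1) / 2)
        * expR (- wkb_phase alpha beta (eucl_norm x))).
Proof.
have N0 : (0 < N)%N by exact: leq_trans N2.
have [C1 [k [C10 HC1]]] := eigen_polynomial_bound l1 l2.
(* One degree above the a priori growth, so that d |x|^n wins at infinity for every d > 0. *)
pose n := k.+1.
(* The first terms are the threshold of [wkb_supersolution] with l = |l1|; the last one makes r^n a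
   supersolution. *)
pose X0 : R := `|l1| + beta ^+ 2 / 8 + beta / 2 + 4 + 2 * (n%:R * (n%:R + N%:R)).
have X00 : 0 <= X0.
  have nN : 0 <= n%:R * (n%:R + N%:R) :> R by rewrite mulr_ge0// addr_ge0.
  by rewrite /X0; move: beta2 (normr_ge0 l1) (sqr_ge0 beta) nN; lra.
have sig0 : 0 < (beta - 2) / 4 by rewrite divr_gt0// subr_gt0.
have [r0 r01 Hr0] := powR_ge_threshold _ _ _ sig0 X00.
have rr0 : 0 < r0 by exact: lt_trans r01.
pose E r := r `^ ((alpha - beta) / 4 - (N%:R - 1) / 2) * expR (- wkb_phase alpha beta r).
have E0 r : 0 < r -> 0 < E r by move=> h; rewrite mulr_gt0 ?powR_gt0 ?expR_gt0.
pose S := C1 * (1 + r0) ^+ k.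
have S0 : 0 < S by rewrite mulr_gt0// exprn_gt0// addr_gt0.
(* [S] bounds |u| on the ball of radius [r0], and [M] makes [M w] equal to [S] on its boundary. *)
pose M := S / wkb alpha beta m r0.
have w0 r : 0 < wkb alpha beta m r by exact: expR_gt0.
have M0 : 0 < M by rewrite divr_gt0.
(* The first term serves outside the ball of radius [r0], the second in the shell between radii 1
   and [r0]. *)
exists (2 * M + S / E r0); first by rewrite addr_gt0 ?divr_gt0 ?E0// mulr_gt0.
move=> u1 u2 su iW IW x x1; have {}HC1 := HC1 u1 u2 su iW IW.
rewrite -/(E (eucl_norm x)).
have ex0 : 0 < eucl_norm x by exact: lt_le_trans x1.
have [xr0|xr0] := leP (eucl_norm x) r0.
  apply: (@le_trans _ _ (S / E r0 * E (eucl_norm x))); last first.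
    by rewrite ler_wpM2r ?(ltW (E0 _ ex0))// lerDr mulr_ge0// ltW.
  apply: (@le_trans _ _ S).
    apply: le_trans (HC1 x) _; rewrite ler_wpM2l ?(ltW C10)//.
    by rewrite lerXn2r ?nnegrE ?addr_ge0 ?lerD2l// ltW.
  (* [E] is nonincreasing: its power of r has a nonpositive exponent and the phase increases. *)
  have EE : E r0 <= E (eucl_norm x).
    apply: ler_pM; [exact: powR_ge0|exact: expR_ge0| |by rewrite ler_expR lerN2 wkb_phase_le].
    have ee : (alpha - beta) / 4 - (N%:R - 1) / 2 <= 0.
      by move: m_ge1; rewrite /m; move: alpha2 beta2; lra.
    rewrite -[X in _ `^ X <= _]opprK -[X in _ <= _ `^ X]opprK !(powRN _ (- _)).
    rewrite lef_pV2 ?posrE ?powR_gt0//; apply: ge0_ler_powR; rewrite ?nnegrE ?oppr_ge0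
      ?(ltW ex0) ?(ltW rr0)//.
  move: (E0 _ rr0) EE; move: (E r0) (E (eucl_norm x)) => p q p0 pq.
  by rewrite mulrAC ler_pdivlMr// ler_wpM2l// ltW.
apply: (@le_trans _ _ (M * wkb alpha beta m (eucl_norm x))); last first.
  apply: (@le_trans _ _ (2 * M * E (eucl_norm x))).
    by rewrite -mulrA mulrCA ler_wpM2l ?(ltW M0)// wkb_le.
  by rewrite ler_wpM2r ?(ltW (E0 _ ex0))// lerDl divr_ge0 ?ltW ?E0.
(* Since [x] is fixed, letting [e] tend to 0 amounts to letting the coefficient d of |x|^n tend to
   0. *)
apply/ler_addgt0Pr => e e0.
pose d := e / eucl_norm x ^+ n.
have d0 : 0 < d by rewrite divr_gt0// exprn_gt0.
have -> : e = d * eucl_norm x ^+ n by rewrite /d divfK// expf_neq0// gt_eqF.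
pose w := wkb alpha beta m; pose w1 := wkb_log1 alpha beta m; pose w2 := wkb_log2 alpha beta m.
apply: (exterior_comparison _ _ _ _ (fun r => M * w r + d * r ^+ n)
  (fun r => M * (w r * w1 r) + d * (n%:R * r ^+ n.-1))
  (fun r => M * (w r * (w1 r ^+ 2 + w2 r)) + d * (n%:R * (n.-1%:R * r ^+ n.-2)))
  r0 N0 r01 su _ _ _ _ _ _ _ (ltW xr0)).
- move=> r r1; apply: is_derive_add; apply: is_derive_scale; first exact: is_derive_wkb.
  by apply: is_derive_val (is_derive_exprn _ n _ _ _ (is_derive_id _ _)) _; rewrite mulr1.
- move=> r r1; apply: is_derive_add; apply: is_derive_scale; first exact: is_derive_wkb1.
  apply: is_derive_scale.
  by apply: is_derive_val (is_derive_exprn _ n.-1 _ _ _ (is_derive_id _ _)) _; rewrite mulr1.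
- move=> r r0r; have rp := lt_le_trans rr0 r0r.
  apply: addr_gt0; first exact: (mulr_gt0 M0 (w0 r)).
  exact: (mulr_gt0 d0 (exprn_gt0 n rp)).
- move=> y; have [r ry] : exists r, r = eucl_norm y by exists (eucl_norm y).
  rewrite -ry => r0r.
  have r1 := lt_trans r01 r0r; have rp := lt_trans rr0 r0r.
  have Xr := Hr0 r (ltW r0r).
  have nN : 0 <= n%:R * (n%:R + N%:R) :> R by rewrite mulr_ge0// addr_ge0.
  have b8 := sqr_ge0 beta.
  have rb : r `^ ((beta - 2) / 4) <= r `^ beta.
    by rewrite ler_powR ?(ltW r1)//; move: beta2; lra.
  have ll := ler_norm (- l1); rewrite normrN in ll.
  (* A positive lower bound for the real coefficient on the whole sphere, against which both parts
     of the barrier are tested. *)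
  pose q := (r `^ beta - `|l1|) / (1 + r `^ alpha).
  have ap : 0 < 1 + r `^ alpha by rewrite ltr_wpDr ?powR_ge0.
  have q0 : 0 < q.
    rewrite divr_gt0// subr_gt0; apply: lt_le_trans rb; apply: lt_le_trans Xr.
    by rewrite /X0; move: beta2; lra.
  have qA : q <= eigen_re alpha beta l1 y.
    rewrite /eigen_re /coef_V /coef_a -ry ler_wpM2r ?invr_ge0 ?(ltW ap)//.
    by rewrite lerD2l; move: ll; lra.
  split; first exact: lt_le_trans qA.
  apply: (@le_trans _ _ (q * (M * w r + d * r ^+ n))); last first.
    by rewrite ler_wpM2r// addr_ge0// mulr_ge0// ?exprn_ge0// ltW// ?w0.
  have s1 : w1 r ^+ 2 + w2 r + 2 * m / r * w1 r <= q.
    apply: wkb_supersolution => //.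
    by apply: le_trans Xr; rewrite /X0 lerDl mulr_ge0.
  have s2 : n%:R * (n.-1%:R * r ^+ n.-2) + (N%:R - 1) / r * (n%:R * r ^+ n.-1) <= q * r ^+ n.
    have -> : n%:R * (n.-1%:R * r ^+ n.-2) + (N%:R - 1) / r * (n%:R * r ^+ n.-1) =
        n%:R * (n%:R + N%:R - 2) / r ^+ 2 * r ^+ n.
      (* For n = 1 the exponent [n.-2] truncates to 0, but its coefficient [n.-1] vanishes. *)
      rewrite /n succnK; case: (k) => [|j].
        by rewrite expr1 expr0 /=; field; rewrite gt_eqF.
      rewrite !exprS succnK -(natr1 j.+1) -(natr1 j); move: (r ^+ j) => a.
      by field; rewrite gt_eqF.
    rewrite ler_wpM2r ?exprn_ge0 ?(ltW rp)// /q ler_pdivrMr ?exprn_gt0// mulrAC.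
    rewrite ler_pdivlMr//.
    apply: (@le_trans _ _ (n%:R * (n%:R + N%:R) * (2 * r ^+ 2))).
      apply: ler_pM => //; rewrite ?(ltW ap)//.
      - rewrite mulr_ge0// subr_ge0; apply: (@le_trans _ _ N%:R); last by rewrite lerDr.
        by rewrite (ler_nat _ 2) ltnW.
      - by rewrite ler_wpM2l// lerBlDr lerDl.
      - exact: one_add_powR_le _ _ alpha2 (ltW r1).
    rewrite mulrCA mulrA ler_wpM2r ?sqr_ge0//.
    rewrite lerBrDr; apply: le_trans rb; apply: le_trans Xr.
    by rewrite /X0; move: beta2 b8; lra.
  have s3 : M * (w r * (w1 r ^+ 2 + w2 r)) + (N%:R - 1) / r * (M * (w r * w1 r)) <= q * (M * w r).
    have -> : M * (w r * (w1 r ^+ 2 + w2 r)) + (N%:R - 1) / r * (M * (w r * w1 r)) =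
      (w1 r ^+ 2 + w2 r + 2 * m / r * w1 r) * (M * w r).
      by rewrite /m; field; rewrite gt_eqF.
    by rewrite ler_wpM2r// mulr_ge0// ltW.
  have s4 : d * (n%:R * (n.-1%:R * r ^+ n.-2)) + (N%:R - 1) / r * (d * (n%:R * r ^+ n.-1))
      <= q * (d * r ^+ n).
    rewrite [_ / r * _]mulrCA -mulrDr [q * _]mulrCA ler_wpM2l// ltW//.
  by rewrite (mulrDr q) (mulrDr ((N%:R - 1) / r)) addrACA; exact: lerD.
- move=> y yr0; apply: (@le_trans _ _ (M * w r0)); last first.
    by rewrite lerDl mulr_ge0// ?exprn_ge0// ltW.
  by rewrite /M divfK ?gt_eqF// (le_trans (HC1 y))// yr0.
(* For |y| >= 1 the a priori bound is at most C1 (2 |y|)^k, which d |y|^(k+1) exceeds once |y| >= C1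
   2^k / d. *)
- exists (Num.max 1 (C1 * 2 ^+ k / d)) => y; rewrite ge_max => /andP[y1 yd].
  apply: le_trans (HC1 y) _.
  apply: (@le_trans _ _ (d * eucl_norm y ^+ n)); last first.
    by rewrite lerDr mulr_ge0// ltW// w0.
  have y0 : 0 <= eucl_norm y by exact: eucl_norm_ge0.
  apply: (@le_trans _ _ (C1 * (2 * eucl_norm y) ^+ k)).
    rewrite ler_wpM2l ?(ltW C10)// lerXn2r ?nnegrE ?addr_ge0 ?mulr_ge0//; move: y1; lra.
  rewrite exprMn mulrA /n exprS mulrA ler_wpM2r ?exprn_ge0//.
  by rewrite [leRHS]mulrC -ler_pdivrMr.
Qed.

End decay.

Theorem corollary3p6 (R : realType) (N : nat) (alpha beta : R)
  (hN : (2 < N)%N) (halpha : 0 <= alpha < 2) (hbeta : 2 < beta)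
  (lambda : R[i]) :
  exists2 C : R, 0 < C &
    forall psi : 'rV[R]_N -> R[i],
      continuousC psi ->
      normalized_eigenfunction alpha beta lambda psi ->
      forall x : 'rV[R]_N, 1 <= eucl_norm x ->
        normc (psi x) <=
          C * eucl_norm x `^ ((alpha - beta) / 4 - (N%:R - 1) / 2)
            * expR (- \int[lebesgue_measure]_(s in `[1, eucl_norm x])
                        (s `^ (beta / 2) / (1 + s `^ alpha) `^ (1 / 2))).
Proof.
have /andP[a0 a2] := halpha.
have [C C0 HC] := wkb_decay alpha beta hN a0 a2 hbeta
  (complex.Re lambda) (complex.Im lambda).
exists C => // psi cpsi [Apsi npsi] x x1.
have b0 : 0 <= beta by apply: ltW; apply: lt_trans hbeta.
have su := eigenfunction_schroedinger alpha beta lambda psi a0 b0 cpsi Apsi.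
have [iW IW] := L2norm1_modulus psi cpsi npsi.
rewrite normc_modulus -mulrA; apply: HC su iW _ x x1.
by rewrite IW.
Qed.
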